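(* For any integer $n\ge 2$, \[ P_{n,2}^{\max} = \begin{cases}1 & n+1 \text{ odd}\\ 2p_t & n+1\equiv 2\pmod 4\\ p_t & n+1\equiv 0 \pmod 4\end{cases}, \] where $t$ is the odd part of $n+1$ and $p_t = \prod_{d\mid t}\left(1 - 2^{-o_d(2)}\right)^{\phi(d)/o_d(2)}$. For any odd prime $p$ and $n\ge 2$, \[ P_{n,p}^{\max} = 1 - \frac{1}{p^2+p+1} + O\left(\sum_{d=0}^{\lfloor n/2\rfloor}\delta_{n,p}(2d) + \frac{1}{p^n}\right), \] where the implied constant is absolute.
   Context: For odd $d$, $o_d(2)$ is the order of $2$ in $(\mathbb{Z}/d\mathbb{Z})^\times$; $\phi$ is Euler's function. For a prime $p$, let $U_n(\mathbb{Z}_p)$ be the set of monic degree $n$ polynomials in $\mathbb{Z}_p[x]$ all of whose coefficients are not divisible by $p$, viewed via its non-leading coefficients as a subset of $\mathbb{Z}_p^n$ with normalized Haar measure $\lambda_p$. $P_{n,p}^{\max} = \lambda_p(\{f\in U_n(\mathbb{Z}_p): \mathbb{Z}_p[x]/(f(x)) \text{ is the maximal order of } \mathbb{Q}_p[x]/(f(x))\})/\lambda_p(U_n(\mathbb{Z}_p))$. Let $\mathbb{F}_p[x]_m$ be the set of monic polynomials in $\mathbb{F}_p[x]$. For $u\in\mathbb{F}_p[x]_m$ and $\alpha\in\mathbb{F}_p[x]/(u)$, let $\mathcal{A}_n(u;\alpha) = \{(a_1,\ldots,a_n)\in(\mathbb{F}_p\setminus\{0\})^n : a_1x^{n-1}+\cdots+a_n\equiv\alpha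 \bmod u\}$, and \[ \delta_{n,p}(d) = \max_{\substack{u\in\mathbb{F}_p[x]_m,\ \deg u = d,\ x\nmid u}}\ \max_{\alpha\in\mathbb{F}_p[x]/(u)}\left|\frac{|\mathcal{A}_n(u;\alpha)|}{(p-1)^n} - \frac{1}{p^d}\right|. \] *)

(* Defs.v *)
From HB Require Import structures.
From mathcomp Require Import all_boot all_order all_algebra all_fingroup.
From mathcomp Require Import all_classical all_reals all_analysis.
Set Implicit Arguments.
Unset Strict Implicit.
Unset Printing Implicit Defensive.
Import Order.TTheory GRing.Theory Num.Theory.
Local Open Scope classical_set_scope.
Local Open Scope ring_scope.

(* The ring Z_p as the inverse limit of the rings Z/p^k: [x k] is the residue *)
(* of x modulo p^k, as a natural number (compatibility forces [x k < p ^ k]). *)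
(* The primality proof is a parameter so that instances can depend on it.     *)
Record padic (p : nat) (p_pr : prime p) := Padic {
  padic_val :> nat -> nat;
  _ : `[< forall k, padic_val k = (padic_val k.+1 %% p ^ k)%N >] }.

HB.instance Definition _ p p_pr := [isSub for @padic_val p p_pr].
HB.instance Definition _ p p_pr := [Choice of @padic p p_pr by <:].

Section PadicRing.
Variables (p : nat) (p_pr : prime p).
Local Notation Zp := (padic p_pr).
Implicit Types x y z : Zp.

Let p_gt0 : (0 < p)%N. Proof. exact: prime_gt0. Qed.
Let pX_gt0 k : (0 < p ^ k)%N. Proof. by rewrite expn_gt0 p_gt0. Qed.

Lemma padicS x k : x k = (x k.+1 %% p ^ k)%N.
Proof. by case: x => v /= /asboolP. Qed.

Lemma padic_small x k : (x k %% p ^ k)%N = x k.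
Proof. by rewrite padicS modn_mod. Qed.

Lemma padic_modS x k : x k.+1 = x k %[mod p ^ k].
Proof. by rewrite padic_small -padicS. Qed.

Lemma padicD x k j : x k = (x (k + j)%N %% p ^ k)%N.
Proof.
elim: j => [|j IHj]; first by rewrite addn0 padic_small.
by rewrite IHj addnS (padicS x (k + j)) modn_dvdm // dvdn_exp2l // leq_addr.
Qed.

Lemma padic_eqP x y : (forall k, x k = y k) -> x = y.
Proof. by move=> xy; apply: val_inj; apply/funext. Qed.

Definition padic_of (a : nat -> nat) (aP : forall k, a k.+1 = a k %[mod p ^ k])
  : Zp.
Proof.
exists (fun k => a k %% p ^ k)%N; apply/asboolP => k.
by rewrite modn_dvdm ?dvdn_exp2l // aP.
Defined.

Fact padic_add_subproof x y k :
  (x k.+1 + y k.+1 = x k + y k %[mod p ^ k])%N.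
Proof. by rewrite -modnDm -!padicS. Qed.

Fact padic_mul_subproof x y k :
  (x k.+1 * y k.+1 = x k * y k %[mod p ^ k])%N.
Proof. by rewrite -modnMm -!padicS. Qed.

Fact padic_opp_subproof x k :
  (p ^ k.+1 - x k.+1 = p ^ k - x k %[mod p ^ k])%N.
Proof.
have le j : (x j <= p ^ j)%N by rewrite -padic_small ltnW // ltn_pmod.
apply/eqP; rewrite -(eqn_modDr (x k.+1)) subnK // -modnDmr -padicS subnK //.
by rewrite modnn expnS modnMl.
Qed.

Definition padic_nat (a : nat) : Zp := @padic_of (fun=> a) (fun=> erefl).
Definition padic_add x y := padic_of (padic_add_subproof x y).
Definition padic_mul x y := padic_of (padic_mul_subproof x y).
Definition padic_opp x := padic_of (padic_opp_subproof x).

Fact padic_addA : associative padic_add.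
Proof. by move=> x y z; apply: padic_eqP => k /=; rewrite modnDml modnDmr addnA. Qed.
Fact padic_addC : commutative padic_add.
Proof. by move=> x y; apply: padic_eqP => k /=; rewrite addnC. Qed.
Fact padic_add0 : left_id (padic_nat 0) padic_add.
Proof. by move=> x; apply: padic_eqP => k /=; rewrite mod0n add0n padic_small. Qed.
Fact padic_addN : left_inverse (padic_nat 0) padic_opp padic_add.
Proof.
move=> x; apply: padic_eqP => k /=; rewrite modnDml subnK ?modnn ?mod0n //.
by rewrite -padic_small ltnW // ltn_pmod.
Qed.

HB.instance Definition _ := GRing.isZmodule.Build Zp
  padic_addA padic_addC padic_add0 padic_addN.

Fact padic_mulA : associative padic_mul.
Proof. by move=> x y z; apply: padic_eqP => k /=; rewrite modnMml modnMmr mulnA. Qed.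
Fact padic_mulC : commutative padic_mul.
Proof. by move=> x y; apply: padic_eqP => k /=; rewrite mulnC. Qed.
Fact padic_mul1 : left_id (padic_nat 1) padic_mul.
Proof. by move=> x; apply: padic_eqP => k /=; rewrite modnMml mul1n padic_small. Qed.
Fact padic_mulD : left_distributive padic_mul padic_add.
Proof.
move=> x y z; apply: padic_eqP => k /=.
by rewrite modnMml modnDml modnDmr mulnDl.
Qed.
Fact padic_1neq0 : padic_nat 1 != 0.
Proof.
apply/eqP => /(congr1 (fun x : Zp => x 1%N)) /=.
by rewrite expn1 mod0n modn_small // prime_gt1.
Qed.

HB.instance Definition _ := GRing.Zmodule_isComNzRing.Build Zp
  padic_mulA padic_mulC padic_mul1 padic_mulD padic_1neq0.

Definition padic_unit : pred Zp := fun x => `[< exists y, y * x = 1 >].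
Definition padic_inv x : Zp :=
  if pselect (exists y, y * x = 1) is left ex then projT1 (cid ex) else x.

Fact padic_mulV : {in padic_unit, left_inverse 1 padic_inv *%R}.
Proof.
move=> x /asboolP ex; rewrite /padic_inv; case: pselect => // ex'.
by case: cid.
Qed.
Fact padic_unitP x y : y * x = 1 -> padic_unit x.
Proof. by move=> yx1; apply/asboolP; exists y. Qed.
Fact padic_inv_out : {in [predC padic_unit], padic_inv =1 id}.
Proof.
move=> x /negP nx; rewrite /padic_inv; case: pselect => // ex.
by case: nx; apply/asboolP.
Qed.

HB.instance Definition _ := GRing.ComNzRing_hasMulInverse.Build Zp
  padic_mulV padic_unitP padic_inv_out.

Lemma padic_neq0 x : x != 0 -> exists k, ~~ (p ^ k %| x k)%N.
Proof.
move=> /eqP x0; apply: contrapT => nex; apply: x0; apply: padic_eqP => k.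
have /negP/negPn/eqP := contra_not (fun H => ex_intro _ k H) nex.
by rewrite padic_small => -> /=; rewrite mod0n.
Qed.

Fact padic_integral x y : x * y = 0 -> (x == 0) || (y == 0).
Proof.
move=> xy0; apply/norP => -[/padic_neq0[i xi] /padic_neq0[j yj]].
have ndvd (z : Zp) a b : ~~ (p ^ a %| z a)%N -> ~~ (p ^ a %| z (a + b))%N.
  by rewrite {1}(padicD z a b) /dvdn modn_mod.
have xk := ndvd _ _ j xi; have yk := ndvd _ _ i yj; rewrite addnC in yk.
have pos m a : ~~ (p ^ a %| m)%N -> (0 < m)%N by case: m; rewrite ?dvdn0.
have x_gt0 := pos _ _ xk; have y_gt0 := pos _ _ yk.
have: (p ^ (i + j) %| x (i + j) * y (i + j))%N.
  have /(congr1 (fun z : Zp => z (i + j)%N)) /= := xy0.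
  by rewrite /dvdn mod0n => ->.
rewrite !pfactor_dvdn ?muln_gt0 ?x_gt0 // lognM // in xk yk *.
move: xk yk; rewrite -!ltnNge => xk yk; apply/negP; rewrite -ltnNge.
by rewrite -addnS leq_add // ltnW.
Qed.

HB.instance Definition _ := GRing.ComUnitRing_isIntegral.Build Zp
  padic_integral.

(* The p-adic topology: U is open when it contains, with x, some x + p^k Z_p. *)
Definition padic_open (U : set Zp) :=
  forall x, U x -> exists k, [set y : Zp | y k = x k] `<=` U.

Fact padic_openT : padic_open setT. Proof. by move=> x _; exists 0%N. Qed.
Fact padic_openI : setI_closed padic_open.
Proof.
move=> U V oU oV x [/oU[i Ui] /oV[j Vj]]; exists (i + j)%N => y /= yx.
split; first by apply: Ui; rewrite /= (padicD y i j) yx -padicD.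
by apply: Vj; rewrite /= (padicD y j i) addnC yx addnC -padicD.
Qed.
Fact padic_open_bigU (I : Type) (f : I -> set Zp) :
  (forall i, padic_open (f i)) -> padic_open (\bigcup_i f i).
Proof.
move=> of_ x [i _ fix_]; have [k ik] := of_ i x fix_.
by exists k => y /ik; exists i.
Qed.

HB.instance Definition _ := isPointed.Build Zp 0.
HB.instance Definition _ := isOpenTopological.Build Zp
  padic_openT padic_openI padic_open_bigU.

End PadicRing.

(* Z_p^n with its Borel sigma-algebra (for the product topology on 'rV_n). *)
Definition padic_space (p : nat) (p_pr : prime p) (n : nat) :=
  g_sigma_algebraType (@open 'rV[padic p_pr]_n).

Section Haar.
Variables (R : realType) (p : nat) (p_pr : prime p) (n : nat).

(* The normalized Haar measure, through the properties characterizing it. *)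
Definition is_haar (mu : probability (padic_space p_pr n) R) :=
  forall (v : 'rV[padic p_pr]_n) (A : set (padic_space p_pr n)),
    measurable A -> mu [set v + x | x in (A : set 'rV_n)] = mu A.

End Haar.

Section Orders.
Variables (Z : idomainType) (A : comAlgType {fraction Z}).
Implicit Types O : set A.

Definition is_subring O :=
  [/\ O 1, forall a b, O a -> O b -> O (a - b)
    & forall a b, O a -> O b -> O (a * b)].

Definition fin_gen_module O := exists (m : nat) (e : 'I_m -> A),
  O = [set \sum_i (tofrac (c i)) *: e i | c in [set: 'I_m -> Z]].

Definition spans_algebra O := forall a : A,
  exists (m : nat) (c : 'I_m -> {fraction Z}) (e : 'I_m -> A),
    (forall i, O (e i)) /\ a = \sum_i c i *: e i.

Definition is_order O :=
  [/\ is_subring O, fin_gen_module O & spans_algebra O].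

(* As A is commutative, the product of two orders is an order, so that an     *)
(* order which is maximal for inclusion contains every order.                 *)
Definition is_maximal_order O :=
  is_order O /\ forall O', is_order O' -> O `<=` O' -> O' = O.

End Orders.

Section MaximalMonogenic.
Variable Z : idomainType.
Implicit Types f g : {poly Z}.

Definition fracp f : {poly {fraction Z}} := map_poly (@tofrac Z) f.

(* Z[x]/(f) inside Frac(Z)[x]/(f), for f monic. [{poly %/ h}] is the quotient *)
(* by h only when h is monic of positive degree.                              *)
Definition monogenic_order f : set {poly %/ fracp f} :=
  [set in_qpoly (fracp f) (fracp g) | g in [set: {poly Z}]].

Arguments monogenic_order f : clear implicits.

Definition is_maximal f := is_maximal_order (monogenic_order f).

End MaximalMonogenic.

Section Pmax.
Variables (R : realType) (p : nat) (p_pr : prime p) (n : nat).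
Local Notation Zp := (padic p_pr).

Definition U_set : set {poly Zp} :=
  [set f | [/\ f \is monic, size f = n.+1 &
     forall i : 'I_n.+1, ~ exists b : Zp, f`_i = p%:R * b]].

Definition monic_of_coefs (c : 'rV[Zp]_n) : {poly Zp} :=
  'X^n + \sum_(i < n) c 0 i *: 'X^i.

Definition Pmax (mu : probability (padic_space p_pr n) R) : R :=
  fine (mu [set c | U_set (monic_of_coefs c)
                    /\ is_maximal (monic_of_coefs c)])
  / fine (mu [set c | U_set (monic_of_coefs c)]).

End Pmax.

(* The order of 2 in the unit group of Z/dZ, for d odd. As ['Z_1] is Z/2, in  *)
(* which 2 is not a unit, the default 1 gives o_1(2) = 1, as it should.       *)
Definition ord2 (d : nat) : nat :=
  #[insubd (1%g : {unit 'Z_d}) (2%:R : 'Z_d)]%g.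

Definition p_of (R : realType) (t : nat) : R :=
  \prod_(d <- divisors t) (1 - 2%:R ^- ord2 d) ^+ (totient d %/ ord2 d).

Section Delta.
Variables (R : realType) (n p : nat).

(* Elements of F_p[x]/(u) with deg u = d are represented by their remainders, *)
(* the polynomials alpha of degree < d: unlike [{poly %/ u}], this is also    *)
(* right for u = 1. [a 0 i] is the coefficient a_(i+1).                       *)
Definition A_set (u alpha : {poly 'F_p}) : {set 'rV['F_p]_n} :=
  [set a : 'rV['F_p]_n | [forall i, a 0 i != 0] &&
     (u %| (\sum_(i < n) a 0 i *: 'X^(n - i.+1) - alpha))]%SET.

(* The maximum of a nonempty finite family of nonnegative reals, hence the 0. *)
Definition delta (d : nat) : R :=
  \big[Num.max/0]_(u : {poly_d.+1 'F_p} |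
      [&& (u : {poly 'F_p}) \is monic, size u == d.+1
        & ~~ ('X %| (u : {poly 'F_p}))])
    \big[Num.max/0]_(alpha : {poly_d 'F_p})
      `| #|A_set u alpha|%:R / (p.-1)%:R ^+ n - (p%:R ^+ d)^-1 |.

End Delta.

(* Main.v *)
Require Import Defs.
From HB Require Import structures.
From mathcomp Require Import all_boot all_order all_algebra all_fingroup.
From mathcomp Require Import all_classical all_reals all_analysis.
From mathcomp Require Import cyclic separable cyclotomic finfield qfpoly.
From mathcomp Require Import ring lra zify.
Set Implicit Arguments.
Unset Strict Implicit.
Unset Printing Implicit Defensive.
Import Order.TTheory GRing.Theory Num.Theory.
Local Open Scope ring_scope.

(* By Dedekind's criterion Z_p[x]/(f) is maximal iff f lies in the square of  *)
(* no ideal (p, U) with U irreducible modulo p. This only depends on f modulo *)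
(* p^2: writing f = f0 + p g with f0 a digitwise lift of f mod p, each monic  *)
(* irreducible u with u^2 | f mod p forbids one residue class of g modulo u.  *)
(* As g mod p is uniform, the Chinese remainder theorem gives the conditional *)
(* probability prod_(u^2 | f mod p) (1 - p^-deg u), so Pmax is the average of *)
(* this product over the tuples of nonzero coefficients modulo p.             *)
(* For p = 2 there is only one tuple, and (x - 1) f = (x^t - 1)^(2^k) mod 2,  *)
(* with x^t - 1 squarefree: its factors of order d are phi(d) / o_d(2) many,  *)
(* of degree o_d(2).                                                          *)
(* For odd p, the product is expanded over the squarefree v (products of sets *)
(* J of irreducibles): the probability that v^2 | f is p^(-2 deg v) up to     *)
(* delta(2 deg v), there are at most p^d polynomials v of degree d, and the   *)
(* Moebius sums over degree d are 1 for d = 0 and 1 - p for d > 0, so that    *)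
(* the main term is a truncated geometric series.                             *)

Lemma fraction_clear_denom (Z : idomainType) (a : {fraction Z}) :
  exists2 d : Z, d != 0 & exists c, tofrac d * a = tofrac c.
Proof.
pose x : {ratio Z} := generic_quotient.repr a; exists (frac x).2; first exact: denom_ratioP.
exists (frac x).1; rewrite -[a]generic_quotient.reprK -/x; unlock tofrac.
rewrite -[LHS]FracField.pi_mul; apply/generic_quotient.eqmodP => /=.
rewrite FracField.equivfE /FracField.mulf.
by rewrite !numden_Ratio ?oner_neq0 ?mul1r ?mulr1 ?denom_ratioP // mulrC.
Qed.

Lemma fracp_clear_denom (Z : idomainType) (q : {poly {fraction Z}}) :
  exists2 d : Z, d != 0 & exists g : {poly Z}, tofrac d *: q = fracp g.
Proof.
elim/poly_ind: q => [|q c [d d0 [g dq]]].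
  by exists 1; rewrite ?oner_neq0 //; exists 0; rewrite /fracp rmorph0 scaler0.
have [e e0 [b eb]] := fraction_clear_denom c.
exists (d * e); first by rewrite mulf_neq0.
exists ((e *: g) * 'X + (d * b)%:P).
rewrite [in RHS]/fracp !(rmorphD, rmorphM) /= map_polyX map_polyZ /=.
rewrite !map_polyC /= -[map_poly _ g]dq -eb -!mul_polyC !polyCM.
by ring.
Qed.

Lemma dvdp_irreducible (k : fieldType) (w : {poly k}) :
  (1 < size w)%N -> exists2 u, irreducible_poly u & u %| w.
Proof.
have [n] := ubnP (size w); elim: n w => // n IHn w; rewrite ltnS => wn w1.
have [wirr|wred] := pselect (irreducible_poly w); first by exists w.
have [q [q1 qw qNw]] : exists q : {poly k}, [/\ size q != 1%N, q %| w & ~~ (q %= w)].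
  apply: contrapT => H; apply: wred; split=> // q q1 qw.
  by apply: contrapT => /negP qNw; apply: H; exists q.
have w0 : w != 0 by rewrite -size_poly_gt0 ltnW.
have q0 : q != 0 by apply: contraNneq w0 => q0; rewrite q0 dvd0p in qw.
have [] := IHn q.
- by rewrite (leq_trans _ wn) // ltn_neqAle dvdp_leq // dvdp_size_eqp // qNw.
- by rewrite ltn_neqAle eq_sym q1 size_poly_gt0.
by move=> u uirr uq; exists u => //; apply: dvdp_trans uq qw.
Qed.

Lemma eqp_irreducible (k : fieldType) (u v : {poly k}) :
  u %= v -> irreducible_poly u -> irreducible_poly v.
Proof.
move=> uv [u1 ui]; split=> [|q q1]; first by rewrite -(eqp_size uv).
by rewrite -(eqp_dvdr _ uv) => /(ui _ q1) /eqp_trans; apply.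
Qed.

Lemma monic_associate (k : fieldType) (u : {poly k}) : u != 0 ->
  exists2 l, l != 0 & l *: u \is monic.
Proof.
move=> u0; exists (lead_coef u)^-1; first by rewrite invr_eq0 lead_coef_eq0.
by rewrite monicE lead_coefZ mulVf // lead_coef_eq0.
Qed.

Lemma dvdp_monic_irreducible (k : fieldType) (w : {poly k}) : (1 < size w)%N ->
  exists u, [/\ u \is monic, irreducible_poly u & u %| w].
Proof.
move=> /dvdp_irreducible[u ui uw].
have [l l0 lm] := monic_associate (irredp_neq0 ui).
have lu := eqp_scale u l0.
exists (l *: u); split=> //; last by rewrite (eqp_dvdl _ lu).
by apply: eqp_irreducible ui; rewrite eqp_sym.
Qed.

Section Integral.
Variables (Z : idomainType) (A : comAlgType {fraction Z}).

(* The determinant trick. *)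
Lemma fin_gen_integral (O : set A) (y : A) :
  is_subring O -> fin_gen_module O -> O y ->
  exists2 P : {poly Z}, P \is monic &
    (map_poly (GRing.in_alg A \o @tofrac Z) P).[y] = 0.
Proof.
move=> [mem1 _ OM] [m [e Oe]] Oy.
set phi := GRing.in_alg A \o @tofrac Z.
have Oei i : O (e i).
  rewrite Oe; exists (fun j => (j == i)%:R) => //.
  rewrite (bigD1 i) //= eqxx tofrac1 scale1r big1 ?addr0 // => j /negPf ->.
  by rewrite tofrac0 scale0r.
have Mex i : exists r : 'rV[Z]_m, y * e i = \sum_j tofrac (r 0 j) *: e j.
  have := OM _ _ Oy (Oei i); rewrite Oe => -[c _ <-].
  by exists (\row_j c j); apply: eq_bigr => j _; rewrite mxE.
have [rw rwE] := choice Mex.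
pose M : 'M[Z]_m := \matrix_i rw i.
pose E : 'cV[A]_m := \col_i e i.
pose D : 'M[A]_m := map_mx (fun p => (map_poly phi p).[y]) (char_poly_mx M).
have DE : D *m E = 0.
  apply/matrixP => i j; rewrite !mxE (eq_bigr (fun l =>
    (i == l)%:R * (y * e l) - tofrac (rw i 0 l) *: e l)); last first.
    move=> l _; rewrite !mxE raddfB /= map_polyC /= hornerD hornerN hornerC.
    rewrite raddfMn /= map_polyX hornerMn hornerX mulrBl.
    by rewrite !mulrnAl mul1r mulr_algl.
  rewrite sumrB (bigD1 i) //= eqxx mul1r big1 ?addr0 ?rwE ?subrr //.
  by move=> l; rewrite eq_sym => /negPf ->; rewrite mul0r.
exists (char_poly M); first exact: char_poly_monic.
have detD : \det D = (map_poly phi (char_poly M)).[y].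
  have cphi : commr_rmorph phi y by move=> x; apply: mulrC.
  pose h : {rmorphism {poly Z} -> A} := horner_morph cphi.
  by rewrite /char_poly -[RHS]/(h _) -det_map_mx.
rewrite -detD.
have detE : \det D *: E = 0 by rewrite -mul_scalar_mx -mul_adj_mx -mulmxA DE mulmx0.
have: O 1 by []; rewrite Oe => -[c _ c1].
rewrite -[LHS]mulr1 -c1 mulr_sumr big1 // => i _.
rewrite -scalerAr; have /matrixP/(_ i 0) := detE; rewrite !mxE => ->.
by rewrite scaler0.
Qed.

End Integral.

Lemma irreducible_dvdp_mul (k : fieldType) (u p q : {poly k}) :
  irreducible_poly u -> (u %| p * q) = (u %| p) || (u %| q).
Proof.
move=> uirr; apply/idP/orP => [upq|[]]; last 2 first.
- exact: dvdp_mulr.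
- exact: dvdp_mull.
have [up|uNp] := boolP (u %| p); [by left | right].
by rewrite -(@Gauss_dvdpr _ q p u) ?irreducible_poly_coprime.
Qed.

Lemma split_lshift m n (i : 'I_m) : fintype.split (lshift n i) = inl i.
Proof. exact: (unsplitK (inl i : 'I_m + 'I_n)). Qed.

Lemma split_rshift m n (i : 'I_n) : fintype.split (rshift m i) = inr i.
Proof. exact: (unsplitK (inr i : 'I_m + 'I_n)). Qed.

Section AbstractOrder.
Variables (Z : idomainType) (A : comAlgType {fraction Z}).
Variables (f : {poly Z}) (iota : {rmorphism {poly Z} -> A}).
Hypothesis f_monic : f \is monic.
Hypothesis iotaZ : forall c g, iota (c *: g) = tofrac c *: iota g.
Hypothesis iota_eq0 : forall g, iota g = 0 -> exists q, g = q * f.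
Hypothesis iota_f : iota f = 0.
Hypothesis iota_frac : forall a : A,
  exists2 d : Z, d != 0 & exists g, tofrac d *: a = iota g.

Lemma mul_iota_eq0 (d : Z) (a : A) : d != 0 -> tofrac d *: a = 0 -> a = 0.
Proof.
move=> d0 /(congr1 (fun x => (tofrac d)^-1 *: x)).
by rewrite scaler0 scalerA mulVf ?scale1r // tofrac_eq0.
Qed.

Lemma scale_tofrac_inj (d : Z) (a b : A) :
  d != 0 -> tofrac d *: a = tofrac d *: b -> a = b.
Proof.
move=> d0 ab; apply/eqP; rewrite -subr_eq0; apply/eqP.
by apply: (mul_iota_eq0 d0); rewrite scalerBr ab subrr.
Qed.

Lemma iota_eq (g h : {poly Z}) : iota g = iota h -> exists q, g = h + q * f.
Proof.
move=> gh; have [|q qE] := @iota_eq0 (g - h).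
  by rewrite rmorphB gh subrr.
by exists q; rewrite -qE addrC subrK.
Qed.

Lemma iota_small (g : {poly Z}) :
  exists c : 'I_(size f).-1 -> Z, iota g = \sum_i tofrac (c i) *: iota 'X^i.
Proof.
pose r := Pdiv.CommonRing.rmodp g f; exists (fun i => r`_i).
have -> : iota g = iota r.
  rewrite [g](Pdiv.RingMonic.rdivp_eq f_monic).
  by rewrite rmorphD rmorphM iota_f mulr0 add0r.
have rs : (size r <= (size f).-1)%N.
  have := Pdiv.CommonRing.ltn_rmodp g f; rewrite (monic_neq0 f_monic).
  by rewrite -/r => rs; rewrite -ltnS prednK // (leq_ltn_trans _ rs).
rewrite -[in LHS](coefK r) (poly_def (size r)).
rewrite (big_ord_widen _ (fun i => r`_i *: 'X^i) rs).
rewrite rmorph_sum big_mkcond; apply: eq_bigr => i _ /=.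
by case: ltnP => ri; [rewrite iotaZ | rewrite nth_default // tofrac0 scale0r].
Qed.

Definition adjoin (y : A) : set A :=
  [set a | exists g, exists h, a = iota g + iota h * y]%classic.

Lemma is_order_adjoin (y : A) :
  (exists g, exists h, y * y = iota g + iota h * y) -> is_order (adjoin y).
Proof.
move=> [g0 [h0 yy]]; split.
- split=> [|_ _ [g [h ->]] [g' [h' ->]]|_ _ [g [h ->]] [g' [h' ->]]].
  + by exists 1, 0; rewrite rmorph1 rmorph0 mul0r addr0.
  + by exists (g - g'), (h - h'); rewrite !rmorphB; ring.
  + exists (g * g' + h * h' * g0), (g * h' + h * g' + h * h' * h0).
    rewrite !(rmorphD, rmorphM) /=.
    have -> : (iota g + iota h * y) * (iota g' + iota h' * y) =
       iota g * iota g' + (iota g * iota h' + iota h * iota g') * y +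
       iota h * iota h' * (y * y) by ring.
    by rewrite yy; ring.
- pose n := (size f).-1.
  exists (n + n)%N, (fun i => match fintype.split i with
    inl j => iota 'X^j | inr j => iota 'X^j * y end).
  apply/seteqP; split=> [_ [g [h ->]]|_ [c _ <-]].
  + have [cg ->] := iota_small g; have [ch ->] := iota_small h.
    exists (fun i => match fintype.split i with inl j => cg j | inr j => ch j end) => //.
    rewrite big_split_ord /= mulr_suml; congr (_ + _); apply: eq_bigr => i _.
      by rewrite split_lshift.
    by rewrite split_rshift -scalerAl.
  + exists (\sum_i c (lshift n i) *: 'X^i), (\sum_i c (rshift n i) *: 'X^i).
    rewrite big_split_ord /= !rmorph_sum /= mulr_suml.
    congr (_ + _); apply: eq_bigr => i _; rewrite iotaZ ?split_lshift //.
    by rewrite split_rshift -scalerAl.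
- move=> a; have [d d0 [g da]] := iota_frac a.
  exists 1%N, (fun _ => (tofrac d)^-1), (fun=> iota g); split.
    by move=> _; exists g, 0; rewrite rmorph0 mul0r addr0.
  by rewrite big_ord1 -da scalerA mulVf ?scale1r // tofrac_eq0.
Qed.

Lemma adjoin0 : adjoin 0 = [set iota g | g in [set: {poly Z}]]%classic.
Proof.
apply/seteqP; split=> [_ [g [h ->]]|_ [g _ <-]].
  by exists g => //; rewrite mulr0 addr0.
by exists g, 0; rewrite mulr0 addr0.
Qed.

Lemma sub_adjoin (y : A) : (adjoin 0 `<=` adjoin y)%classic.
Proof. by move=> _ [g [h ->]]; exists g, 0; rewrite rmorph0 mulr0 mul0r. Qed.

Lemma order_integral (O : set A) (u w : {poly Z}) (y : A) :
  is_order O -> O y -> iota u * y = iota w ->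
  exists m, exists q, exists q', w ^+ m = u * q + q' * f.
Proof.
move=> [Osub Ofin _] Oy uy; have [P Pm Py] := fin_gen_integral Osub Ofin Oy.
exists (size P).-1.
pose q := - \sum_(i < (size P).-1) P`_i *: (u ^+ ((size P).-1 - i.+1) * w ^+ i).
exists q; apply: iota_eq; rewrite [RHS]rmorphM rmorphN.
set m := (size P).-1; have sP : size P = m.+1.
  by rewrite /m prednK // size_poly_gt0 monic_neq0.
move: Py; rewrite horner_coef size_map_poly_id0; last first.
  by rewrite /= (eqP Pm) tofrac1 scale1r oner_neq0.
rewrite sP big_ord_recr /= !coef_map /= => Py.
have Pmm : P`_m = 1 by apply/eqP; move: Pm; rewrite monicE lead_coefE.
move: Py; rewrite Pmm tofrac1 scale1r mul1r => /(congr1 (fun z => iota u ^+ m * z)).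
rewrite mulrDr -exprMn uy mulr0 => /eqP; rewrite addrC addr_eq0 => /eqP.
rewrite rmorphXn => ->; rewrite mulrN; congr (- _).
rewrite rmorph_sum !mulr_sumr; apply: eq_bigr => i _.
rewrite coef_map /= iotaZ rmorphM !rmorphXn /= -uy exprMn.
rewrite mulr_algl -!scalerAr; congr (_ *: _).
have -> : iota u ^+ m = iota u * iota u ^+ (m - i.+1) * iota u ^+ i.
  by rewrite -exprS -exprD; congr (_ ^+ _); have := ltn_ord i; lia.
by ring.
Qed.

Section Uniformizer.
Variables (k : fieldType) (red : {rmorphism Z -> k}) (pi : Z).
Hypothesis pi_neq0 : pi != 0.
Hypothesis red_pi : red pi = 0.
Hypothesis red_surj : forall a, exists b, red b = a.
Hypothesis red_eq0 : forall a, red a = 0 -> exists b, a = pi * b.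
Hypothesis dvd_pi : forall d, d != 0 -> exists m, exists e, d * e = pi ^+ m.

Local Notation redp := (map_poly red).

Lemma redp_surj (a : {poly k}) : exists b, redp b = a.
Proof.
have [l lK] := choice red_surj.
exists (\poly_(i < size a) l a`_i); apply/polyP => i.
rewrite coef_map coef_poly; case: ltnP => [_|ai] /=; first exact: lK.
by rewrite rmorph0 nth_default.
Qed.

Lemma redp_eq0 (a : {poly Z}) : redp a = 0 -> exists b, a = pi *: b.
Proof.
move=> a0; have : forall i, exists b, a`_i = pi * b.
  by move=> i; apply: red_eq0; rewrite -coef_map a0 coef0.
move=> /choice[l lE]; exists (\poly_(i < size a) l i); apply/polyP => i.
rewrite coefZ coef_poly; case: ltnP => [_|ai]; first exact: lE.
by rewrite nth_default // mulr0.
Qed.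

Lemma redp_eq (a b : {poly Z}) : redp a = redp b -> exists c, a = b + pi *: c.
Proof.
move=> ab; have [|c cE] := @redp_eq0 (a - b); first by rewrite rmorphB /= ab subrr.
by exists c; rewrite -cE addrC subrK.
Qed.

Lemma redp_scale (b : {poly Z}) : redp (pi *: b) = 0.
Proof. by rewrite map_polyZ /= red_pi scale0r. Qed.

Lemma redpD (p q : {poly Z}) : redp (p + q) = redp p + redp q.
Proof. exact: rmorphD. Qed.

Lemma redpM (p q : {poly Z}) : redp (p * q) = redp p * redp q.
Proof. exact: rmorphM. Qed.

Lemma order_scale (O : set A) (a : A) c :
  is_subring O -> (adjoin 0 `<=` O)%classic -> O a -> O (tofrac c *: a).
Proof.
move=> [_ _ OM] sO Oa; have -> : tofrac c *: a = iota (c%:P) * a.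
  by rewrite -[c%:P]mulr1 mul_polyC iotaZ rmorph1 -scalerAl mul1r.
by apply: OM => //; apply: sO; exists c%:P, 0; rewrite mulr0 addr0.
Qed.

(* f lies outside the square of the ideal (pi, U). *)
Definition regular_at (U : {poly Z}) :=
  forall H r, f = U ^+ 2 * H + pi *: r -> ~~ (redp U %| redp r).

(* If f = H U^2 + pi b U + pi^2 a, then y = H U / pi satisfies                 *)
(* y^2 + b y + a H = 0 in the quotient, hence generates a larger order.       *)
Lemma dedekind_not_maximal (U : {poly Z}) :
  irreducible_poly (redp U) -> ~ regular_at U -> ~ is_maximal_order (adjoin 0).
Proof.
move=> Uirr nreg [_ max]; apply: nreg => H r fE; apply/negP => /dvdpP[b' rE].
have [b bE] := redp_surj b'.
have [|a aE] := @redp_eq r (b * U); first by rewrite rE rmorphM /= bE.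
rewrite {}aE in fE.
pose y := (tofrac pi)^-1 *: iota (H * U).
have piK (z : A) : tofrac pi *: ((tofrac pi)^-1 *: z) = z.
  by rewrite scalerA mulfV ?scale1r // tofrac_eq0.
have Uy : iota U * y = - iota (b * U + pi *: a).
  apply: (scale_tofrac_inj pi_neq0); rewrite scalerAr piK -rmorphM.
  rewrite scalerN -iotaZ; apply/eqP; rewrite -addr_eq0 -rmorphD /=.
  by rewrite mulrCA -expr2 mulrC -fE iota_f.
have yy : y * y = iota (- (a * H)) + iota (- b) * y.
  apply: (scale_tofrac_inj pi_neq0); rewrite scalerAl piK rmorphM -mulrA Uy.
  rewrite -rmorphN -rmorphM scalerDr scalerAr piK -rmorphM -iotaZ -rmorphD /=.
  by congr (iota _); rewrite -!mul_polyC; ring.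
have yO : adjoin y y by exists 0, 1; rewrite rmorph0 rmorph1 mul1r add0r.
have := max (adjoin y) _ (@sub_adjoin y) => Oy; rewrite {}Oy in yO; last first.
  by apply: is_order_adjoin; exists (- (a * H)), (- b).
case: yO => g [h]; rewrite mulr0 addr0 => /(congr1 (fun z => tofrac pi *: z)).
rewrite piK -iotaZ => /iota_eq[q] /(congr1 redp).
rewrite fE redpD !redpM redpD !redp_scale add0r addr0 redpM rmorphXn /= => HUE.
have f0 : redp f != 0 by rewrite monic_neq0 // monic_map.
have H0 : redp H != 0.
  apply: contraNneq f0 => H0; rewrite fE redpD redp_scale addr0 redpM /= H0.
  by rewrite mulr0.
have U0 : redp U != 0 by apply: irredp_neq0.
have : redp U %| 1.
  apply/dvdpP; exists (redp q); apply: (mulfI (mulf_neq0 H0 U0)).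
  by rewrite mulr1 {1}HUE; ring.
by rewrite dvdp1; case: Uirr => + _; case: eqP => // ->.
Qed.

(* In an order O containing z with pi z in Z[x]/(f) but not z, integrality    *)
(* gives an irreducible factor u of f mod pi and y = U H / pi in O, for a lift *)
(* U of u and f = U^2 H + pi r; as U y = - r, integrality of y forces u | r.  *)
Lemma dedekind_maximal :
  (forall U, irreducible_poly (redp U) -> regular_at U) ->
  is_maximal_order (adjoin 0).
Proof.
move=> reg; split.
  by apply: is_order_adjoin; exists 0, 0; rewrite !mulr0 rmorph0 addr0.
move=> O Oord sO; apply/seteqP; split => // z Oz.
have [Osub _ _] := Oord; have [mem1 OB OM] := Osub.
have Oiota g : O (iota g) by apply: sO; exists g, 0; rewrite mulr0 addr0.
have OD a b : O a -> O b -> O (a + b).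
  move=> Oa Ob; rewrite -[b]opprK; apply: (OB _ _ Oa).
  by rewrite -[- b]add0r; apply: OB => //; rewrite -(rmorph0 iota).
suff pi1 : forall z, O z -> adjoin 0 (tofrac pi *: z) -> adjoin 0 z.
  have [d d0 [g dz]] := iota_frac z; have [m [e de]] := dvd_pi d0.
  have: adjoin 0 (tofrac (pi ^+ m) *: z).
    rewrite -de mulrC tofracM -scalerA dz -iotaZ.
    by exists (e *: g), 0; rewrite mulr0 addr0.
  elim: m z Oz {d0 g dz de} => [|m IHm] z Oz; first by rewrite expr0 tofrac1 scale1r.
  rewrite exprSr tofracM -scalerA => /IHm H; apply: pi1 => //; apply: H.
  exact: order_scale.
move=> {}z {}Oz [g [h]]; rewrite mulr0 addr0 => piz {h}.
have f0 : redp f != 0 by rewrite monic_neq0 // monic_map.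
have adj g' : adjoin 0 (iota g') by exists g', 0; rewrite mulr0 addr0.
have [/dvdpP[q' gE]|fNg] := boolP (redp f %| redp g).
  have [q qE] := redp_surj q'.
  have [|s sE] := @redp_eq g (q * f); first by rewrite gE rmorphM /= qE.
  have -> : z = iota s; last by [].
  apply: (scale_tofrac_inj pi_neq0); rewrite piz sE rmorphD rmorphM iota_f mulr0.
  by rewrite add0r iotaZ.
exfalso; have [[a b] /= abE] := Bezoutp (redp g) (redp f).
set v := a * _ + _ in abE.
have [w fvw] : exists w, redp f = w * v.
  by apply/dvdpP; rewrite (eqp_dvdl _ abE) dvdp_gcdr.
have w1 : (1 < size w)%N.
  rewrite ltnNge; apply: contra fNg => w1.
  have w0 : w != 0 by apply: contraNneq f0 => w0; rewrite fvw w0 mul0r.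
  have {w1} : size w == 1%N by rewrite eqn_leq w1 size_poly_gt0.
  move=> /size_poly1P[c c0 wE]; rewrite fvw wE mul_polyC.
  by rewrite (eqp_dvdl _ (eqp_scale _ c0)) (eqp_dvdl _ abE) dvdp_gcdl.
have [u uirr /dvdpP[w2 wE]] := dvdp_irreducible w1.
have [U UE] := redp_surj u; have [W2 W2E] := redp_surj w2.
have [Ag AE] := redp_surj a; have [B BE] := redp_surj b.
pose K := (Ag * g + B * f) * W2.
have fUK : redp f = u * redp K.
  by rewrite fvw wE /K redpM redpD !redpM AE BE W2E -/v; ring.
pose y := iota (Ag * W2) * z.
have Oy : O y by apply: OM.
have piy : tofrac pi *: y = iota K.
  rewrite scalerAr piz -rmorphM /K.
  have -> : (Ag * g + B * f) * W2 = Ag * W2 * g + B * W2 * f by ring.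
  by rewrite rmorphD [X in _ + X]rmorphM iota_f mulr0 addr0.
clearbody K.
have piC (t : A) : iota pi%:P * t = tofrac pi *: t.
  by rewrite -[pi%:P]mulr1 mul_polyC iotaZ rmorph1 -scalerAl mul1r.
have uK : u %| redp K.
  have [|m [q [q' Kq]]] := order_integral (u := pi%:P) (w := K) Oord Oy.
    by rewrite piC.
  move: (congr1 redp Kq); rewrite redpD !redpM map_polyC /= red_pi mul0r add0r.
  rewrite rmorphXn => /= KE.
  have : u %| redp K ^+ m by rewrite KE fUK mulrA dvdp_mulr // dvdp_mull.
  elim: m {Kq KE} => [|m IHm].
    by rewrite dvdp1; case: uirr => + _; case: eqP => // ->.
  by rewrite exprS irreducible_dvdp_mul // => /orP[|/IHm].
have /dvdpP[h' KE] := uK; have [H HE] := redp_surj h'.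
have [|s sE] := @redp_eq K (U * H); first by rewrite KE redpM UE HE mulrC.
have [|r rE] := @redp_eq f (U ^+ 2 * H).
  by rewrite fUK KE redpM rmorphXn /= UE HE; ring.
pose y1 := y - iota s.
have piy1 : tofrac pi *: y1 = iota (U * H).
  by rewrite scalerBr piy sE -iotaZ rmorphD addrK.
have Uy1 : iota U * y1 = iota (- r).
  apply: (scale_tofrac_inj pi_neq0); rewrite scalerAr piy1 -rmorphM -iotaZ.
  apply/eqP; rewrite -subr_eq0 -rmorphB; apply/eqP.
  by rewrite mulrA -expr2 scalerN opprK -rE iota_f.
have Oy1 : O y1 by apply: OB.
have uirr' : irreducible_poly (redp U) by rewrite UE.
have := reg U uirr' H r rE; rewrite UE => /negP; apply.
have [m [q [q' rq]]] := order_integral Oord Oy1 Uy1.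
have : u %| redp (- r) ^+ m.
  rewrite -rmorphXn rq /= redpD !redpM UE.
  apply: dvdp_add; first exact: dvdp_mulr.
  by rewrite fUK mulrCA dvdp_mulr.
rewrite rmorphN /=; elim: m {rq} => [|m IHm].
  by rewrite dvdp1; case: uirr => + _; case: eqP => // ->.
by rewrite exprS irreducible_dvdp_mul // => /orP[|/IHm //]; rewrite dvdpNr.
Qed.

End Uniformizer.
End AbstractOrder.

Section Dedekind.
Variables (Z : idomainType) (k : fieldType) (red : {rmorphism Z -> k}) (pi : Z).
Hypothesis pi_neq0 : pi != 0.
Hypothesis red_pi : red pi = 0.
Hypothesis red_surj : forall a, exists b, red b = a.
Hypothesis red_eq0 : forall a, red a = 0 -> exists b, a = pi * b.
Hypothesis dvd_pi : forall d, d != 0 -> exists m, exists e, d * e = pi ^+ m.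

Lemma dedekind (f : {poly Z}) : f \is monic -> (1 < size f)%N ->
  is_maximal f <->
  forall U, irreducible_poly (map_poly red U) -> regular_at f red pi U.
Proof.
move=> f_monic f_size; pose F := fracp f.
have tofrac0P (z : Z) : tofrac z = 0 -> z = 0.
  by move=> /eqP; rewrite tofrac_eq0 => /eqP.
have F_monic : F \is monic by apply: monic_map.
have F_size : size F = size f.
  by rewrite size_map_poly_id0 // (eqP f_monic) tofrac1 oner_neq0.
have FE : mk_monic F = F by rewrite /mk_monic F_size f_size F_monic.
pose iota : {rmorphism {poly Z} -> {poly %/ F}} := in_qpoly F \o map_poly (@tofrac Z).
have iotaZ (c : Z) (g : {poly Z}) : iota (c *: g) = tofrac c *: iota g.
  by rewrite /= map_polyZ /= in_qpolyZ.
have iota_f : iota f = 0.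
  by apply: val_inj; rewrite /= FE -/F Pdiv.RingMonic.rmodpp.
have iota_eq0 (g : {poly Z}) : iota g = 0 -> exists q, g = q * f.
  move=> g0; exists (Pdiv.CommonRing.rdivp g f).
  have gE := Pdiv.RingMonic.rdivp_eq f_monic g.
  set q := Pdiv.CommonRing.rdivp g f in gE *.
  have := Pdiv.CommonRing.ltn_rmodp g f; rewrite (monic_neq0 f_monic).
  move: gE; set r := Pdiv.CommonRing.rmodp g f => gE rf.
  have: iota r = 0.
    by move: g0; rewrite gE rmorphD rmorphM iota_f mulr0 add0r.
  move=> /(congr1 (@polyn _ _)); rewrite in_qpoly_small; last first.
    by rewrite FE F_size (leq_ltn_trans _ rf) // size_poly.
  move=> /polyP r0; rewrite gE; suff -> : r = 0 by rewrite addr0.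
  by apply/polyP => i; have := r0 i; rewrite coef_map !coef0 => /tofrac0P.
have iota_frac (a : {poly %/ F}) :
    exists2 d : Z, d != 0 & exists g, tofrac d *: a = iota g.
  have [d d0 [g dg]] := fracp_clear_denom (a : {poly {fraction Z}}).
  exists d => //; exists g; rewrite [iota g]/= -[map_poly _ g]dg in_qpolyZ.
  by congr (_ *: _); apply: val_inj; rewrite [RHS]in_qpoly_small // size_mk_monic.
have OE : monogenic_order (f := f) = adjoin iota 0 by rewrite adjoin0.
rewrite /is_maximal OE; split; last first.
  exact: (dedekind_maximal f_monic iotaZ iota_eq0 iota_f iota_frac pi_neq0 red_pi).
move=> fmax U Uirr; apply: contrapT => nreg; move: fmax.
exact: (dedekind_not_maximal f_monic iotaZ iota_eq0 iota_f iota_frac pi_neq0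
  red_pi red_surj red_eq0 Uirr nreg).
Qed.

End Dedekind.

(** * The p-adic integers and their Haar measure *)

Section Padic.
Variables (p : nat) (p_pr : prime p).
Local Notation Zp := (padic p_pr).
Implicit Types x y : Zp.

Let p_gt0 : (0 < p)%N. Proof. exact: prime_gt0. Qed.

Lemma padic_addE x y k : (x + y) k = ((x k + y k) %% p ^ k)%N.
Proof. by []. Qed.

Lemma padic_mulE x y k : (x * y) k = ((x k * y k) %% p ^ k)%N.
Proof. by []. Qed.

Lemma padic_natE n k : (n%:R : Zp) k = (n %% p ^ k)%N.
Proof.
elim: n => [|n IHn]; first by [].
by rewrite mulrS padic_addE IHn /= modnDml modnDmr addnC addn1.
Qed.

Lemma padic_lt x k : (x k < p ^ k)%N.
Proof. by rewrite -padic_small ltn_pmod // expn_gt0 p_gt0. Qed.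

Lemma padic0 x : x 0%N = 0%N.
Proof. by have := padic_lt x 0; rewrite expn0 ltnS leqn0 => /eqP. Qed.

Definition padic_red x : 'F_p := (x 1%N)%:R.

Fact padic_red_zmod : zmod_morphism padic_red.
Proof.
move=> x y; apply/eqP; rewrite eq_sym subr_eq /padic_red -natrD.
by rewrite -[in X in X == _](subrK y x) padic_addE expn1 Fp_nat_mod.
Qed.

Fact padic_red_monoid : monoid_morphism padic_red.
Proof.
split; first by rewrite /padic_red (padic_natE 1) expn1 Fp_nat_mod.
by move=> x y; rewrite /padic_red padic_mulE expn1 Fp_nat_mod // natrM.
Qed.

HB.instance Definition _ := GRing.isZmodMorphism.Build Zp 'F_p padic_red
  padic_red_zmod.
HB.instance Definition _ := GRing.isMonoidMorphism.Build Zp 'F_p padic_red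
  padic_red_monoid.

Lemma padic_red_nat n : padic_red n%:R = n%:R.
Proof. exact: rmorph_nat. Qed.

Lemma padic_red_surj (a : 'F_p) : padic_red (a : nat)%:R = a.
Proof. by rewrite padic_red_nat natr_Zp. Qed.

Lemma padic_red_p : padic_red p%:R = 0.
Proof. by rewrite padic_red_nat; apply/eqP; have := pchar_Fp p_pr; case/andP. Qed.

Lemma padic_red0P x : padic_red x = 0 -> x 1%N = 0%N.
Proof.
move=> /(congr1 val); rewrite /= val_Fp_nat // modn_small //.
by rewrite -[X in (_ < X)%N]expn1 padic_lt.
Qed.

Lemma padic_dvd_p x k : x 1%N = 0%N -> (p %| x k.+1)%N.
Proof.
by move=> x1; rewrite /dvdn -[X in (_ %% X)%N]expn1 -(padicD x 1 k) x1.
Qed.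

Lemma padic_red_eq0 x : padic_red x = 0 -> exists y, x = p%:R * y.
Proof.
move=> /padic_red0P x1.
have compat k : (x k.+2 %/ p = x k.+1 %/ p %[mod p ^ k])%N.
  rewrite (padicS x k.+1) -{1}(divnK (padic_dvd_p k.+1 x1)).
  rewrite expnSr -{2}(divnK (padic_dvd_p k.+1 x1)) -muln_modl mulnK //.
  by rewrite [in RHS]mulnK // modn_mod.
exists (@padic_of p p_pr _ compat); apply: padic_eqP => k.
rewrite padic_mulE padic_natE /= modnMml modnMmr mulnC.
by rewrite divnK ?padic_dvd_p // -padicS.
Qed.

Lemma padic_red_unit x : padic_red x != 0 -> exists y, x * y = 1.
Proof.
move=> x0.
have x_coprime k : coprime (x k) (p ^ k).
  case: k => [|k]; first by rewrite expn0 coprimen1.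
  rewrite coprime_pexpr // coprime_sym prime_coprime //.
  apply: contraNN x0 => pxk; rewrite /padic_red (padicD x 1 k) expn1.
  by rewrite (eqP pxk).
have inv k : (x k * x k ^ (totient (p ^ k)).-1 = 1 %[mod p ^ k])%N.
  rewrite -expnS prednK ?totient_gt0 ?expn_gt0 ?p_gt0 //.
  exact: Euler_exp_totient.
have compat k : (x k.+1 ^ (totient (p ^ k.+1)).-1 =
                 x k ^ (totient (p ^ k)).-1 %[mod p ^ k])%N.
  set a := (x k.+1 ^ _)%N; set b := (x k ^ _)%N.
  have : (x k * a = x k * b %[mod p ^ k])%N.
    rewrite inv -modnMml -padic_modS modnMml.
    have := congr1 (modn^~ (p ^ k)%N) (inv k.+1).
    by rewrite /= !modn_dvdm ?dvdn_exp2l.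
  move=> /eqP ab; apply/eqP; move: ab.
  wlog ab : a b / (b <= a)%N => [H|].
    case/orP: (leq_total a b) => [ab|/H //].
    by rewrite eq_sym [in X in _ -> X]eq_sym; apply: H.
  by rewrite !eqn_mod_dvd ?leq_mul2l ?ab ?orbT // -mulnBr Gauss_dvdr // coprime_sym.
exists (@padic_of p p_pr _ compat); apply: padic_eqP => k.
by rewrite padic_mulE /= modnMmr inv.
Qed.

Lemma padic_p_neq0 : (p%:R : Zp) != 0.
Proof.
apply/eqP => /(congr1 (fun x : Zp => x 2)); rewrite padic_natE (padic_natE 0).
rewrite mod0n modn_small; last by rewrite -[X in (X < _)%N]expn1 ltn_exp2l ?prime_gt1.
by move=> p0; move: p_gt0; rewrite p0.
Qed.

Lemma padic_mulpE x k : (p%:R * x) k.+1 = (p * x k)%N.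
Proof.
by rewrite padic_mulE padic_natE modnMml expnS -muln_modr (padicS x k).
Qed.

Lemma padic_dvd_pX x : x != 0 -> exists m, exists y, x * y = p%:R ^+ m.
Proof.
move=> /padic_neq0[k]; have : x k != 0%N -> exists m, exists y, x * y = p%:R ^+ m.
  elim: k x => [|k IHk] x; first by rewrite padic0.
  have [/padic_red_eq0[y ->]|/padic_red_unit[y xy] _] := eqVneq (padic_red x) 0.
    rewrite padic_mulpE muln_eq0 negb_or => /andP[_ /IHk[m [z yz]]].
    by exists m.+1, z; rewrite -mulrA yz exprS.
  by exists 0%N, y.
by move=> H xk; apply: H; apply: contraNneq xk => ->; rewrite dvdn0.
Qed.

Lemma padic_p2 x : x 2 = 0%N -> exists y, x = p%:R ^+ 2 * y.
Proof.
move=> x2; have [|y xE] := @padic_red_eq0 x.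
  by rewrite /padic_red (padicD x 1 1) x2 mod0n.
have [|z yE] := @padic_red_eq0 y.
  move: x2; rewrite xE padic_mulpE => /eqP; rewrite muln_eq0.
  by rewrite (gtn_eqF p_gt0) /padic_red => /eqP ->.
by exists z; rewrite xE yE mulrA expr2.
Qed.

Lemma padic_sub2 x y : (x - y) 2 = 0%N <-> x 2 = y 2.
Proof.
split=> [xy|xy]; last first.
  have : (x - y + y) 2 = y 2 by rewrite subrK.
  rewrite padic_addE -[in RHS](padic_small y) -[in RHS](add0n (y 2)) => /eqP.
  rewrite eqn_modDr mod0n => /eqP; by rewrite padic_small.
by rewrite -(subrK y x) padic_addE xy add0n padic_small.
Qed.

End Padic.

Section HaarDigits.
Variables (p : nat) (p_pr : prime p) (n : nat).
Local Notation Zp := (padic p_pr).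
Local Notation word := ('rV['F_p]_n * 'rV['F_p]_n)%type.

Definition digit1 (x : Zp) : 'F_p := (x 2 %/ p)%:R.

Definition digits (c : 'rV[Zp]_n) : word :=
  (map_mx (@padic_red p p_pr) c, map_mx digit1 c).

Definition of_digits (w : word) : 'rV[Zp]_n :=
  \row_i (w.1 0%R i + p * w.2 0%R i)%:R.

Let p_gt0 : (0 < p)%N. Proof. exact: prime_gt0. Qed.

Lemma Fp_lt (a : 'F_p) : (a < p)%N.
Proof. by rewrite -{2}(Fp_cast p_pr) ltn_ord. Qed.

Lemma padic_mod2E (x : Zp) : x 2 = (padic_red x + p * digit1 x)%N.
Proof.
rewrite /padic_red /digit1 !val_Fp_nat // -[X in (x 1 %% X)%N]expn1 padic_small.
rewrite (modn_small (m := x 2 %/ p)%N); last by rewrite ltn_divLR // mulnn padic_lt.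
by rewrite (padicD x 1 1) expn1 addnC mulnC -divn_eq.
Qed.

Lemma digits_bound (a b : 'F_p) : (a + p * b < p ^ 2)%N.
Proof.
rewrite -mulnn (@leq_trans (p + p * b)) ?ltn_add2r ?Fp_lt //.
by rewrite -mulnS leq_pmul2l // Fp_lt.
Qed.

Lemma of_digitsE (w : word) i : of_digits w 0 i 2 = (w.1 0%R i + p * w.2 0%R i)%N.
Proof. by rewrite mxE padic_natE modn_small // digits_bound. Qed.

Lemma of_digits0 i : of_digits (0, 0) 0 i 2 = 0%N.
Proof. by rewrite of_digitsE !mxE /= muln0. Qed.

Lemma digits_inj (a b a' b' : 'F_p) :
  (a + p * b = a' + p * b')%N -> a = a' /\ b = b'.
Proof.
move=> ab; have := congr1 (modn^~ p) ab.
rewrite /= ![(p * _)%N]mulnC ![(_ + _ * p)%N]addnC !modnMDl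
  !modn_small ?Fp_lt // => /val_inj aa.
split=> //; apply: val_inj; move: ab; rewrite aa => /addnI/eqP.
by rewrite eqn_mul2l (gtn_eqF p_gt0) => /eqP.
Qed.

Lemma digitsP (c : 'rV[Zp]_n) (w : word) :
  digits c = w <-> forall i, c 0 i 2 = of_digits w 0 i 2.
Proof.
split=> [<- i|cw]; first by rewrite of_digitsE !mxE padic_mod2E.
have cwi i : padic_red (c 0 i) = w.1 0 i /\ digit1 (c 0 i) = w.2 0 i.
  by apply: digits_inj; rewrite -padic_mod2E cw of_digitsE.
case: w cw cwi => a b _ /= cwi; congr pair; apply/rowP => i; rewrite !mxE.
  by have [] := cwi i.
by have [] := cwi i.
Qed.

Lemma of_digitsK : cancel of_digits digits.
Proof. by move=> w; apply/digitsP. Qed.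

Lemma open_digits (P : set word) : open [set c : 'rV[Zp]_n | P (digits c)]%classic.
Proof.
rewrite openE => c /= Pc.
exists (fun _ i => [set x : Zp | x 2 = c 0 i 2]%classic) => [j i|d /= dc].
  rewrite ord1; apply: open_nbhs_nbhs; split=> //.
  by move=> x /= xc; exists 2 => y /= yx; rewrite -xc.
suff -> : digits d = digits c by [].
by apply/digitsP => i; rewrite dc; move: (digitsP c (digits c)) => [/(_ erefl)].
Qed.

Variables (R : realType) (mu : probability (padic_space p_pr n) R).
Hypothesis mu_haar : is_haar mu.

Lemma measurable_digits (P : set word) :
  measurable ([set c | P (digits c)]%classic : set (padic_space p_pr n)).
Proof. by apply: sub_sigma_algebra; apply: open_digits. Qed.

Lemma haar_cell (w : word) :
  mu [set c | digits c = w]%classic = mu [set c | digits c = (0, 0)]%classic.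
Proof.
rewrite -(mu_haar (of_digits w) (measurable_digits (fun w => w = (0, 0)))); congr (mu _).
apply/seteqP; split=> [c /= cw|_ [c /= c0 <-]].
  exists (c - of_digits w); last by rewrite addrC subrK.
  apply/digitsP => i; rewrite of_digits0 2!mxE.
  by apply/padic_sub2; have /digitsP := cw.
apply/digitsP => i; have /digitsP/(_ i) := c0; rewrite of_digits0 => c0i.
by rewrite [in LHS]mxE padic_addE c0i addn0 padic_small.
Qed.

Lemma haar_digits (P : pred word) :
  mu [set c | P (digits c)]%classic = (#|P|%:R / p%:R ^+ (2 * n))%:E.
Proof.
pose m0 := mu [set c | digits c = (0, 0)]%classic.
have sum_cells (Q : pred word) : mu [set c | Q (digits c)]%classic = m0 *+ #|Q|.
  have -> : [set c | Q (digits c)]%classic =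
    (\bigcup_(w in [set` enum Q]) [set c | digits c = w])%classic.
    apply/seteqP; split=> [c /= Qc|c [w /=]]; last by rewrite mem_enum => Qw ->.
    by exists (digits c) => //=; rewrite mem_enum.
  rewrite measure_fin_bigcup //; last 2 first.
  - by move=> w w' _ _ [c [/= -> ->]].
  - move=> w _; exact: (measurable_digits [set w]%classic).
  rewrite -fsbig_seq ?enum_uniq //= (eq_bigr _ (fun w _ => haar_cell w)).
  by rewrite big_enum /= sumr_const.
have card_word : #|{: word}| = (p ^ (2 * n))%N.
  by rewrite card_prod !card_mx card_Fp // mul1n mul2n -addnn expnD.
have := sum_cells predT; rewrite (_ : [set c | _]%classic = setT); last first.
  by apply/seteqP; split.
rewrite probability_setT sum_cells.
rewrite (_ : #|predT| = (p ^ (2 * n))%N) //.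
have : m0 \is a fin_num.
  apply: fin_num_measure; exact: (measurable_digits (fun w => w = (0, 0))).
have natmulE (x : R) k : (x%:E : \bar R) *+ k = (x *+ k)%:E.
  by elim: k => [//|k IHk]; rewrite !mulrS IHk.
move=> /fineK <-; rewrite !natmulE.
move: (fine m0) => m [m1]; congr (_%:E).
have pn0 : p%:R ^+ (2 * n) != 0 :> R by rewrite expf_neq0 // pnatr_eq0 -lt0n.
by apply: (mulIf pn0); rewrite divfK // mulrnAl -natrX mulr_natr -m1.
Qed.

End HaarDigits.

(** * Counting polynomials that avoid residue classes *)

Section CountPoly.
Variables (F : finFieldType).
Implicit Types (m u c g : {poly F}).

Lemma chinese_poly m u c d : coprimep m u ->
  exists c', forall g, (m * u %| g - c') = (m %| g - c) && (u %| g - d).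
Proof.
move=> mu; have [[a b] /= ab1] := Bezout_eq1_coprimepP _ _ mu.
exists (d * a * m + c * b * u) => g; rewrite Gauss_dvdp //; congr (_ && _).
  have -> : g - (d * a * m + c * b * u) = (g - c) + (c * a - d * a) * m.
    by rewrite -[c in g - c]mulr1 -ab1; ring.
  by rewrite dvdp_addl // dvdp_mull.
have -> : g - (d * a * m + c * b * u) = (g - d) + (d * b - c * b) * u.
  by rewrite -[d in g - d]mulr1 -ab1; ring.
by rewrite dvdp_addl // dvdp_mull.
Qed.

Lemma card_congr_poly n m c : m != 0 -> (size m <= n.+1)%N ->
  #|[pred g : {poly_n F} | m %| (g : {poly F}) - c]| = (#|F| ^ (n - (size m).-1))%N.
Proof.
move=> m0 mn; set k := (n - (size m).-1)%N.
have m_gt0 : (0 < size m)%N by rewrite size_poly_gt0.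
pose f (h : {poly_k F}) : {poly_n F} := npolyp n (c %% m + m * (h : {poly F})).
have fE h : f h = c %% m + m * (h : {poly F}) :> {poly F}.
  apply: npolypK; rewrite (leq_trans (size_polyD _ _)) // geq_max; apply/andP; split.
    by rewrite -ltnS (leq_trans _ mn) // ltn_modp.
  have [->|h0] := eqVneq (h : {poly F}) 0; first by rewrite mulr0 size_poly0.
  rewrite size_mul //; have := size_npoly h; move: (size h) => sh.
  rewrite /k; move: mn m_gt0; rewrite /k; clear.
  by move: (size m) => sm; lia.
have f_inj : injective f.
  move=> h h' /(congr1 (fun g : {poly_n F} => g : {poly F})); rewrite !fE.
  by move=> /addrI /(mulfI m0) /val_inj.
rewrite -card_npoly -(card_imset _ f_inj) cardE -cardE; apply: eq_card => g.
rewrite inE; apply/idP/imsetP => [mg|[h _ ->]]; last first.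
  rewrite fE {2}(divp_eq c m).
  have -> : c %% m + m * h - (c %/ m * m + c %% m) = m * ((h : {poly F}) - c %/ m).
    by ring.
  by rewrite dvdp_mulr.
have gE : (g : {poly F}) %% m = c %% m.
  by apply/eqP; rewrite -subr_eq0 -modpN -modpD; apply/eqP/modp_eq0P.
have hk : (size ((g : {poly F}) %/ m)%R <= k)%N.
  by rewrite size_divp // leq_sub2r // size_npoly.
exists (npolyp k (g %/ m)) => //; apply: val_inj => /=.
by rewrite fE npolypK // -gE mulrC addrC -divp_eq.
Qed.

Lemma card_avoid_poly (R : fieldType) n (r : {poly F} -> {poly F}) s m c :
  #|F|%:R != 0 :> R ->
  m != 0 -> all (predC1 0) s -> all (coprimep m) s -> pairwise (@coprimep F) s ->
  (size (m * \prod_(u <- s) u)%R <= n.+1)%N ->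
  #|[pred g : {poly_n F} | (m %| (g : {poly F}) - c) &&
       all (fun u => ~~ (u %| (g : {poly F}) - r u)) s]|%:R =
  #|F|%:R ^+ (n - (size m).-1) *
  \prod_(u <- s) (1 - (#|F|%:R ^+ (size u).-1)^-1) :> R.
Proof.
move=> q0; elim: s m c => [|u s IHs] m c m0.
  move=> _ _ _; rewrite !big_nil !mulr1 => mn.
  rewrite -natrX -(card_congr_poly c) //; congr (_%:R); apply: eq_card => g.
  by rewrite !inE andbT.
move=> /= /andP[u0 s0] /andP[mu ms] /andP[us ss]; rewrite !big_cons => mn; rewrite mulrA in mn.
have mu0 : m * u != 0 by rewrite mulf_neq0.
have P0 : \prod_(v <- s) v != 0 by rewrite prodf_seq_neq0.
have sm_gt0 : (0 < size m)%N by rewrite size_poly_gt0.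
have su_gt0 : (0 < size u)%N by rewrite size_poly_gt0.
have sP_gt0 : (0 < size (\prod_(v <- s) v)%R)%N by rewrite size_poly_gt0.
have smu : size (m * u) = (size m + size u).-1 by rewrite size_mul.
move: (mn); rewrite size_mul // smu => mn'.
have mP : (size (m * \prod_(v <- s) v)%R <= n.+1)%N.
  have arith a b d N : (0 < b -> ((a + b).-1 + d).-1 <= N -> (a + d).-1 <= N)%N.
    by clear; lia.
  by rewrite size_mul //; apply: arith su_gt0 mn'.
have [c' c'E] := chinese_poly c (r u) mu.
have mus : all (coprimep (m * u)) s.
  by apply/allP => v vs; rewrite coprimepMl (allP ms v vs) (allP us v vs).
have IH1 := IHs m c m0 s0 ms ss mP.
have IH2 := IHs (m * u) c' mu0 s0 mus ss mn.
set N1 := #|_| in IH1; set N2 := #|_| in IH2; set N := #|_|.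
have NE : (N1 = N2 + N)%N.
  rewrite /N1 -(cardID [pred g : {poly_n F} | u %| (g : {poly F}) - r u]); congr (_ + _)%N.
    by apply: eq_card => g; rewrite !inE c'E andbAC.
  by apply: eq_card => g; rewrite !inE andbCA.
have -> : N%:R = N1%:R - N2%:R :> R by rewrite NE natrD addrC addKr.
rewrite IH1 IH2 smu.
have -> : (n - (size m).-1)%N = (n - (size m + size u).-2 + (size u).-1)%N.
  have arith a b d M : (0 < a -> 0 < b -> 0 < d -> ((a + b).-1 + d).-1 <= M.+1 ->
    M - a.-1 = M - (a + b).-2 + b.-1)%N.
    by clear; lia.
  exact: arith sP_gt0 mn'.
rewrite exprD; set qu := _ ^+ (size u).-1.
have qu0 : qu != 0 by rewrite expf_neq0.
by field.
Qed.

End CountPoly.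

Section RegularAt.
Variables (Z : idomainType) (k : fieldType) (red : {rmorphism Z -> k}) (pi : Z).
Hypothesis pi_neq0 : pi != 0.
Hypothesis red_pi : red pi = 0.
Hypothesis red_surj : forall a, exists b, red b = a.
Hypothesis red_eq0 : forall a, red a = 0 -> exists b, a = pi * b.
Local Notation redp := (map_poly red).

Lemma scalep_inj (q r : {poly Z}) : pi *: q = pi *: r -> q = r.
Proof.
by rewrite -!mul_polyC; apply: mulfI; rewrite polyC_eq0.
Qed.

Lemma regular_at_add (f z U : {poly Z}) :
  regular_at f red pi U -> regular_at (f + pi *: (pi *: z)) red pi U.
Proof.
move=> reg H r fE; have := reg H (r - pi *: z); rewrite redpD.
have -> : redp (- (pi *: z)) = 0 by rewrite rmorphN /= redp_scale ?oppr0.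
rewrite addr0; apply; rewrite scalerBr addrA -fE; ring.
Qed.

(* Whether f lies in the square of (pi, U) only depends on U modulo pi and up *)
(* to a unit.                                                                 *)
Lemma regular_at_indep (U H r U' H' r' : {poly Z}) (l : k) :
  l != 0 -> redp U' != 0 -> redp U = l *: redp U' ->
  U ^+ 2 * H + pi *: r = U' ^+ 2 * H' + pi *: r' ->
  redp U' %| redp r' -> redp U %| redp r.
Proof.
move=> l0 U'0 UU' eqf U'r'; rewrite UU' (eqp_dvdl _ (eqp_scale _ l0)).
have [m ml] := red_surj l.
have [|V UE] := @redp_eq _ _ _ _ red_eq0 U (m *: U').
  by rewrite map_polyZ /= ml.
have redeqf := congr1 redp eqf; move: redeqf.
rewrite !redpD !redp_scale // !addr0 ![redp (_ ^+ 2 * _)]redpM !rmorphXn /= UU' => redeqf.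
have [|H1 H'E] := @redp_eq _ _ _ _ red_eq0 H' (m ^+ 2 *: H).
  apply: (mulfI (expf_neq0 2 U'0)); rewrite -redeqf map_polyZ /= rmorphXn /= ml.
  by rewrite -!mul_polyC; rewrite !rmorphXn /=; ring.
have eq1 : U' ^+ 2 * H1 + r' = (m%:P * U' * V + m%:P * U' * V + pi *: (V ^+ 2)) * H + r.
  apply: scalep_inj; apply/eqP; rewrite -subr_eq0; apply/eqP.
  move/eqP: eqf; rewrite -subr_eq0 UE H'E -!mul_polyC rmorphXn /= => /eqP eqf.
  by rewrite -[RHS]oppr0 -eqf; ring.
pose a := redp m%:P * redp V + redp m%:P * redp V.
have rE : redp r = redp r' + redp U' * (redp U' * redp H1 - a * redp H).
  have := congr1 redp eq1; rewrite 2!redpD 2!redpM !redpD redp_scale // addr0 !redpM => e.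
  rewrite -[LHS](addKr (redp U' * a * redp H)) /a.
  have -> : redp U' * (redp m%:P * redp V + redp m%:P * redp V) * redp H + redp r =
    (redp m%:P * redp U' * redp V + redp m%:P * redp U' * redp V) * redp H + redp r.
    by ring.
  by rewrite -e; ring.
by rewrite rE dvdp_add // dvdp_mulr.
Qed.
End RegularAt.

Section SquareFactors.
Variables (F : finFieldType) (n : nat).
Implicit Types f u v : {poly F}.

Definition sqirr f : pred {poly_n F} := fun w =>
  [&& (w : {poly F}) \is monic, irreducibleb w & (w : {poly F}) ^+ 2 %| f].

Lemma coprimep_irreducible u v : u \is monic -> v \is monic ->
  irreducible_poly u -> irreducible_poly v -> u != v -> coprimep u v.
Proof.
move=> um vm uirr virr; apply: contraNT.
rewrite irreducible_poly_coprime // negbK => uv.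
rewrite -eqp_monic //; case: virr => _; apply => //.
by case: uirr => + _; case: eqP => // ->.
Qed.

Lemma prod_coprime_dvdp (s : seq {poly F}) f :
  pairwise (@coprimep F) s -> all (fun u => u %| f) s -> \prod_(u <- s) u %| f.
Proof.
elim: s => [|u s IHs] /=; first by rewrite big_nil dvd1p.
move=> /andP[us ss] /andP[uf sf]; rewrite big_cons Gauss_dvdp ?uf ?IHs //.
by rewrite big_seq; elim/big_ind: _ => [|v w cv cw|v vs]; 
  rewrite ?coprimep1 ?coprimepMr ?cv ?cw // (allP us).
Qed.

Lemma irreducible_seq_coprime (A : pred {poly_n F}) k :
  (forall w, A w -> (w : {poly F}) \is monic /\ irreducible_poly w) ->
  pairwise (@coprimep F) [seq (w : {poly F}) ^+ k | w : {poly_n F} <- enum A].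
Proof.
move=> AP; rewrite pairwise_map; have := enum_uniq A; rewrite uniq_pairwise.
apply: (sub_in_pairwise (P := A)) (_ : all _ _); last first.
  by apply/allP => w; rewrite mem_enum.
move=> u v /AP[um ui] /AP[vm vi] uv.
by apply/coprimep_expl/coprimep_expr/coprimep_irreducible.
Qed.

Definition sqirr_seq f := [seq (w : {poly F}) | w : {poly_n F} <- enum (sqirr f)].

Lemma sqirr_seqP f u :
  u \in sqirr_seq f -> [/\ u \is monic, irreducible_poly u & u ^+ 2 %| f].
Proof.
by move=> /mapP[v]; rewrite mem_enum => /and3P[vm /irreducibleP virr vf] ->.
Qed.

(* For F = F_p, the probability that Z_p[x]/(h) is maximal when h is a random *)
(* lift of f.                                                                 *)
Definition sqirr_density (R : realType) f : R :=
  \prod_(w : {poly_n F} | sqirr f w) (1 - (#|F|%:R ^+ (size w).-1)^-1).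

Lemma sqirr_densityE (R : realType) f : sqirr_density R f =
  \prod_(u <- sqirr_seq f) (1 - (#|F|%:R ^+ (size u).-1)^-1).
Proof. by rewrite big_map big_enum. Qed.

Lemma card_avoid_sqirr (R : realType) f (r : {poly F} -> {poly F}) m :
  f != 0 -> (size f <= m.+1)%N ->
  #|[pred g : {poly_m F} |
     [forall w : {poly_n F}, sqirr f w ==> ~~ ((w : {poly F}) %| (g : {poly F}) - r w)]]|%:R =
  #|F|%:R ^+ m * sqirr_density R f :> R.
Proof.
move=> f0 fm; have F0 : #|F|%:R != 0 :> R.
  by rewrite pnatr_eq0 -lt0n; apply/card_gt0P; exists 0.
have sf : all (fun u => u %| f) (sqirr_seq f).
  apply/allP => u /sqirr_seqP[_ _]; apply: dvdp_trans.
  by rewrite expr2 dvdp_mulr.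
have s_coprime : pairwise (@coprimep F) (sqirr_seq f).
  apply: (@irreducible_seq_coprime (sqirr f) 1) => w.
  by case/and3P=> wm /irreducibleP wi _.
have := @card_avoid_poly F R m r (sqirr_seq f) 1 0 F0 (oner_neq0 _).
rewrite size_poly1 subn0 mul1r -sqirr_densityE => <-.
- congr (_%:R); apply: eq_card => g; rewrite !inE dvd1p /=.
  apply/forallP/allP => [H u|H u].
    by move=> /mapP[v]; rewrite mem_enum => vf ->; apply: (implyP (H v)).
  by apply/implyP => uf; apply: H; rewrite map_f // mem_enum.
- by apply/allP => u /sqirr_seqP[um _ _]; apply: monic_neq0.
- by apply/allP => u _; rewrite coprime1p.
- exact: s_coprime.
- rewrite (leq_trans _ fm) // dvdp_leq //.
  exact: prod_coprime_dvdp s_coprime sf.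
Qed.

End SquareFactors.

Section MaximalCount.
Variables (p : nat) (p_pr : prime p) (n : nat).
Hypothesis n_gt0 : (0 < n)%N.
Local Notation Zp := (padic p_pr).
Local Notation redp := (map_poly (@padic_red p p_pr)).
Local Notation pi := (p%:R : Zp).

Definition row_poly (K : nzRingType) (a : 'rV[K]_n) : {poly K} :=
  \sum_(i < n) a 0 i *: 'X^i.

Definition row_monic (K : nzRingType) (a : 'rV[K]_n) : {poly K} :=
  'X^n + row_poly a.

Lemma size_row_poly (K : nzRingType) (a : 'rV[K]_n) : (size (row_poly a) <= n)%N.
Proof.
apply: (leq_trans (size_sum _ _ _)); apply/bigmax_leqP => i _.
by rewrite (leq_trans (size_scale_leq _ _)) // size_polyXn.
Qed.

Lemma size_row_monic (K : nzRingType) (a : 'rV[K]_n) : size (row_monic a) = n.+1.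
Proof. by rewrite size_polyDl size_polyXn // ltnS size_row_poly. Qed.

Lemma row_monic_monic (K : nzRingType) (a : 'rV[K]_n) : row_monic a \is monic.
Proof.
by rewrite monicE lead_coefDl ?lead_coefXn // size_polyXn ltnS size_row_poly.
Qed.

Lemma coef_row_poly (K : nzRingType) (a : 'rV[K]_n) (i : 'I_n) :
  (row_poly a)`_i = a 0 i.
Proof.
rewrite coef_sum (bigD1 i) //= coefZ coefXn eqxx mulr1 big1 ?addr0 // => j ji.
by rewrite coefZ coefXn eq_sym val_eqE (negPf ji) mulr0.
Qed.

Lemma map_row_poly (a : 'rV[Zp]_n) :
  redp (row_poly a) = row_poly (map_mx (@padic_red p p_pr) a).
Proof.
rewrite rmorph_sum; apply: eq_bigr => i _.
by rewrite /= map_polyZ /= map_polyXn mxE.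
Qed.

Lemma map_row_monic (a : 'rV[Zp]_n) :
  redp (row_monic a) = row_monic (map_mx (@padic_red p p_pr) a).
Proof. by rewrite /row_monic rmorphD /= map_polyXn map_row_poly. Qed.

Lemma maximalP (c : 'rV[Zp]_n) : is_maximal (monic_of_coefs c) <->
  forall U, irreducible_poly (redp U) ->
    regular_at (row_monic c) (@padic_red p p_pr) pi U.
Proof.
apply: (@dedekind _ _ (@padic_red p p_pr)).
- exact: padic_p_neq0.
- exact: padic_red_p.
- by move=> a; exists (a : nat)%:R; apply: padic_red_surj.
- exact: padic_red_eq0.
- exact: padic_dvd_pX.
- exact: row_monic_monic.
- by rewrite size_row_monic ltnS.
Qed.

Lemma maximal_mod_p2 (c d : 'rV[Zp]_n) : (forall i, c 0 i 2 = d 0 i 2) ->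
  is_maximal (monic_of_coefs c) -> is_maximal (monic_of_coefs d).
Proof.
move=> cd /maximalP cmax; apply/maximalP => U Uirr.
have zex i : exists z, d 0 i - c 0 i = pi ^+ 2 * z.
  by apply/padic_p2/padic_sub2; rewrite cd.
have [z zE] := choice zex.
have -> : row_monic d = row_monic c + pi *: (pi *: row_poly (\row_i z i)).
  rewrite /row_monic -addrA; congr (_ + _).
  rewrite !scaler_sumr -big_split; apply: eq_bigr => i _ /=.
  by rewrite mxE !scalerA -expr2 -scalerDl -zE addrC subrK.
by apply: regular_at_add; [exact: padic_red_p | exact: cmax].
Qed.

Lemma maximal_digits (c : 'rV[Zp]_n) :
  is_maximal (monic_of_coefs c) <->
  is_maximal (monic_of_coefs (of_digits p_pr (digits c))).
Proof.
have cd : forall i, c 0 i 2 = of_digits p_pr (digits c) 0 i 2 by apply/digitsP.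
by split; apply: maximal_mod_p2.
Qed.

Lemma card_maximal (R : realType) (a : 'rV['F_p]_n) :
  #|[pred b | `[< is_maximal (monic_of_coefs (of_digits p_pr (a, b))) >]]|%:R =
  p%:R ^+ n * sqirr_density n.+1 R (row_monic a) :> R.
Proof.
have f0 : row_monic a != 0 by rewrite monic_neq0 // row_monic_monic.
pose A := row_monic (of_digits p_pr (a, 0)).
have redA : redp A = row_monic a.
  rewrite map_row_monic; congr row_monic.
  by have := of_digitsK p_pr (a, 0) => /(congr1 fst).
have rsurj : forall x : 'F_p, exists b, @padic_red p p_pr b = x.
  by move=> x; exists (x : nat)%:R; apply: padic_red_surj.
have req0 := @padic_red_eq0 p p_pr; have rpi := padic_red_p p_pr.
have tex (u : {poly 'F_p}) : exists t : {poly Zp} * {poly Zp} * {poly Zp},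
    u ^+ 2 %| row_monic a -> redp t.1.1 = u /\ A = t.1.1 ^+ 2 * t.1.2 + pi *: t.2.
  have [/dvdpP[h fE]|_] := boolP (u ^+ 2 %| row_monic a); last first.
    by exists (0, 0, 0).
  have [U UE] := redp_surj rsurj u; have [H HE] := redp_surj rsurj h.
  have [|r rE] := redp_eq req0 (a := A) (b := U ^+ 2 * H).
    by rewrite redA fE redpM rmorphXn /= UE HE mulrC.
  by exists (U, H, r).
have [t tP] := choice tex.
pose r u := - redp (t u).2.
have q_card : #|'F_p| = p by rewrite card_Fp.
have := @card_avoid_sqirr _ n.+1 R (row_monic a) r n f0.
rewrite size_row_monic q_card => /(_ (leqnn _)) <-; congr (_%:R).
rewrite -!sum1_card (reindex (@rVnpoly _ n)); last first.
  by apply: onW_bij; exists (@npoly_rV _ n); [exact: rVnpolyK|exact: npoly_rV_K].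
apply: eq_bigl => b; rewrite !inE.
set g : {poly 'F_p} := rVnpoly b.
have gE : g = row_poly b.
  apply/polyP => i; rewrite /g /= val_insubd qualifE /= size_poly.
  case: (ltnP i n) => [i_n|ni].
    by rewrite coef_rVpoly (coef_row_poly b (Ordinal i_n)) insubT.
  by rewrite !nth_default // (leq_trans _ ni) ?size_row_poly // size_poly.
have [G GE gA] : exists2 G, redp G = g & row_monic (of_digits p_pr (a, b)) = A + pi *: G.
  exists (row_poly (\row_i (b 0 i : nat)%:R)).
    rewrite map_row_poly gE; congr row_poly; apply/rowP => i.
    by rewrite !mxE padic_red_surj.
  rewrite /A /row_monic -addrA; congr (_ + _).
  rewrite scaler_sumr -big_split; apply: eq_bigr => i _ /=.
  by rewrite !mxE /= muln0 addn0 scalerA natrD natrM scalerDl.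
have redAG : redp (A + pi *: G) = row_monic a.
  by rewrite redpD redp_scale // addr0.
apply/asboolP/forallP => [/maximalP mx u|H].
  apply/implyP => /and3P[um /irreducibleP ui uf]; have [tU tA] := tP _ uf.
  have := mx (t u).1.1; rewrite tU gA => /(_ ui (t u).1.2 ((t u).2 + G)).
  rewrite tU redpD GE opprK [g + _]addrC; apply.
  by rewrite scalerDr addrA -tA.
apply/maximalP => U Uirr H' r'; rewrite gA => fE; apply/negP => Ur.
have U0 : redp U != 0 by apply: irredp_neq0.
have [l l0 um] := monic_associate U0; set u := l *: redp U in um.
have uU : u %= redp U by apply: eqp_scale.
have uf : u ^+ 2 %| row_monic a.
  rewrite (eqp_dvdl _ (eqp_exp 2 uU)) -redAG fE redpD redp_scale // addr0 redpM.
  by rewrite rmorphXn /= dvdp_mulr.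
have un : (size u <= n.+1)%N.
  rewrite -(size_row_monic a) dvdp_leq //; apply: dvdp_trans uf.
  by rewrite expr2 dvdp_mulr.
have ui : irreducible_poly u by apply: eqp_irreducible Uirr; rewrite eqp_sym.
have [tU tA] := tP _ uf.
have := H (npolyp n.+1 u); rewrite /sqirr npolypK // um uf (introT (irreducibleP _) ui) /=.
move=> /negP; apply; rewrite opprK addrC -GE -redpD -[X in X %| _]tU.
apply: (regular_at_indep (padic_p_neq0 p_pr) rpi rsurj req0
  (H := (t u).1.2) (H' := H') l0 U0 tU _ Ur).
by rewrite -fE scalerDr addrA -tA.
Qed.

End MaximalCount.

Definition nonzero_row (F : finFieldType) (n : nat) : pred 'rV[F]_n :=
  fun a => [forall i, a 0 i != 0].

Lemma card_nonzero_row (F : finFieldType) (n : nat) :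
  #|@nonzero_row F n| = (#|F|.-1 ^ n)%N.
Proof.
pose f (g : {ffun 'I_n -> F}) : 'rV[F]_n := \row_i g i.
have f_bij : bijective f.
  exists (fun a : 'rV_n => [ffun i => a 0 i]) => [g|a].
    by apply/ffunP => i; rewrite ffunE mxE.
  by apply/rowP => i; rewrite mxE ffunE.
rewrite -sum1_card (reindex f) /=; last exact: onW_bij.
rewrite (eq_bigl [pred g : {ffun 'I_n -> F} | g \in ffun_on (predC1 0)]) => [|g].
  rewrite sum1_card card_ffun_on card_ord; congr (_ ^ _)%N.
  by have := cardC1 (0 : F).
rewrite inE; apply/forallP/ffun_onP => H i; have := H i; first by rewrite mxE inE.
by rewrite inE mxE.
Qed.

Section PmaxFormula.
Variables (R : realType) (p : nat) (p_pr : prime p) (n : nat).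
Hypothesis n_gt0 : (0 < n)%N.
Variable mu : probability (padic_space p_pr n) R.
Hypothesis mu_haar : is_haar mu.
Local Notation word := ('rV['F_p]_n * 'rV['F_p]_n)%type.

Lemma U_setP (c : 'rV[padic p_pr]_n) :
  U_set n (monic_of_coefs c) <-> nonzero_row (digits c).1.
Proof.
have redP (x : padic p_pr) : (~ exists b, x = p%:R * b) <-> padic_red x != 0.
  split=> [nx|/eqP x0 [b xb]].
    by apply/eqP => /padic_red_eq0.
  by apply: x0; rewrite xb rmorphM /= padic_red_p mul0r.
have coefE (i : 'I_n) : (row_monic c)`_i = c 0 i.
  by rewrite coefD coefXn (ltn_eqF (ltn_ord i)) add0r coef_row_poly.
split=> [[_ _ cU]|cU].
  apply/forallP => i; rewrite mxE; apply/redP; rewrite -coefE.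
  exact: (cU (widen_ord (leqnSn n) i)).
split; [exact: row_monic_monic | exact: size_row_monic |].
move=> i; apply/redP; case: (unliftP ord_max i) => [j ->|->].
  have -> : (monic_of_coefs c)`_(lift ord_max j) = c 0 j.
    by rewrite -coefE lift_max.
  by have := forallP cU j; rewrite mxE.
have -> : (monic_of_coefs c)`_(@ord_max n) = 1.
  by have := row_monic_monic c; rewrite monicE lead_coefE size_row_monic => /eqP.
by rewrite rmorph1 oner_neq0.
Qed.

Lemma PmaxE : Pmax mu =
  (\sum_(a : 'rV['F_p]_n | nonzero_row a) sqirr_density n.+1 R (row_monic a))
    / (p.-1)%:R ^+ n.
Proof.
have q_card : #|'F_p| = p by rewrite card_Fp.
pose PU : pred word := fun w => nonzero_row w.1.
pose PA : pred word := fun w => nonzero_row w.1 &&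
  `[< is_maximal (monic_of_coefs (of_digits p_pr w)) >].
rewrite /Pmax.
rewrite (_ : [set c | U_set n (monic_of_coefs c)]%classic =
             [set c | PU (digits c)]%classic); last first.
  by apply/seteqP; split=> c /U_setP.
rewrite (_ : [set c | _ /\ _]%classic = [set c | PA (digits c)]%classic); last first.
  apply/seteqP; split=> c /=.
    by move=> [/U_setP cU cm]; rewrite /PA cU; apply/asboolP; exact: (proj1 (maximal_digits n_gt0 c)).
  by move=> /andP[cU /asboolP cm]; split; [exact/U_setP | exact: (proj2 (maximal_digits n_gt0 c))].
rewrite !haar_digits //= invf_div mulrA divfK; last first.
  by rewrite expf_neq0 // pnatr_eq0 -lt0n prime_gt0.
have card_PU : #|PU|%:R = p%:R ^+ n * (p.-1)%:R ^+ n :> R.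
  rewrite -sum1_card (eq_bigl (fun w => PU w && true)) => [|w]; last by rewrite andbT.
  rewrite -(pair_big_dep (@nonzero_row _ n) (fun _ _ => true) (fun _ _ => 1%N)) /=.
  under eq_bigr do rewrite sum1_card card_mx q_card mul1n.
  by rewrite sum_nat_const card_nonzero_row q_card natrM !natrX mulrC.
have card_PA : #|PA|%:R = p%:R ^+ n *
    \sum_(a : 'rV['F_p]_n | nonzero_row a) sqirr_density n.+1 R (row_monic a) :> R.
  rewrite -sum1_card -(pair_big_dep (@nonzero_row _ n) (fun a b =>
   `[< is_maximal (monic_of_coefs (of_digits p_pr (a, b))) >]) (fun _ _ => 1%N)) /=.
  rewrite natr_sum mulr_sumr; apply: eq_bigr => a _.
  by rewrite sum1_card card_maximal.
by rewrite card_PA card_PU invfM mulrACA divff ?mul1r // expf_neq0 // pnatr_eq0 -lt0n prime_gt0.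
Qed.

End PmaxFormula.

(** * Moebius sums over squarefree polynomials prime to x *)

Lemma prod_add1_subsets (R : comNzRingType) (T : finType) (Q : pred T) (h : T -> R) :
  \prod_(w | Q w) (1 + h w) = \sum_(J : {set T} | J \subset Q) \prod_(w in J) h w.
Proof.
rewrite big_mkcond (eq_bigr (fun w => (if Q w then h w else 0) + 1)); last first.
  by move=> w _; case: ifP; rewrite 1?addrC ?addr0.
rewrite bigA_distr [RHS]big_mkcond; apply: eq_bigr => J _; case: ifPn => [JQ|].
  rewrite [RHS]big_mkcond; apply: eq_bigr => w _.
  by case: ifP => // /(fintype.subsetP JQ); rewrite unfold_in => ->.
case/subsetPn => w wJ /negPf wQ; rewrite (bigD1 w) //= wJ.
by rewrite unfold_in in wQ; rewrite wQ mul0r.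
Qed.

Lemma irreducible_polyX (F : fieldType) : irreducible_poly ('X : {poly F}).
Proof. by have := irredp_XsubC (0 : F); rewrite polyC0 subr0. Qed.

Definition pdeg (K : nzSemiRingType) (f : {poly K}) := (size f).-1.

Lemma pdeg_size (K : nzSemiRingType) (v : {poly K}) : v \is monic -> size v = (pdeg v).+1.
Proof. by move=> vm; rewrite prednK // size_poly_gt0 monic_neq0. Qed.

Lemma pdegM (K : nzSemiRingType) (u v : {poly K}) : u \is monic -> v \is monic ->
  pdeg (u * v) = (pdeg u + pdeg v)%N.
Proof.
move=> um vm; rewrite {1}/pdeg size_Mmonic ?monic_neq0 //.
by rewrite (pdeg_size um) (pdeg_size vm) addnS.
Qed.

Lemma pdeg_prod (K : comNzSemiRingType) (I : Type) (r : seq I) (P : pred I)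
    (G : I -> {poly K}) : (forall i, P i -> G i \is monic) ->
  pdeg (\prod_(i <- r | P i) G i) = (\sum_(i <- r | P i) pdeg (G i))%N.
Proof.
move=> Gm; suff [] : (\prod_(i <- r | P i) G i \is monic) /\
  pdeg (\prod_(i <- r | P i) G i) = (\sum_(i <- r | P i) pdeg (G i))%N by [].
elim/big_ind2: _ => [|x v y u [xm <-] [ym <-]|i /Gm //].
  by rewrite monic1 /pdeg size_poly1.
by rewrite monicMl // ym pdegM.
Qed.

Section SquarefreeProducts.
Variables (F : finFieldType) (N : nat).
Local Notation T := {poly_N.+1 F}.
Local Notation q := #|F|.

Definition irrX : pred T := fun w =>
  [&& (w : {poly F}) \is monic, irreducibleb w & ~~ ('X %| (w : {poly F}))].

Definition vprod (J : {set T}) : {poly F} := \prod_(w in J) (w : {poly F}).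

Lemma vprod_monic (J : {set T}) : J \subset irrX -> vprod J \is monic.
Proof.
by move=> /fintype.subsetP JI; apply: monic_prod => w /JI /and3P[].
Qed.

Lemma dvdp_vprodX (J : {set T}) k f : J \subset irrX ->
  (vprod J ^+ k %| f) = [forall w in J, (w : {poly F}) ^+ k %| f].
Proof.
move=> JI; rewrite /vprod -prodrXl; apply/idP/forall_inP => [Jf w wJ|Jf].
  by apply: dvdp_trans Jf; rewrite (bigD1 w) //= dvdp_mulr.
have Jirr (w : T) : w \in J -> (w : {poly F}) \is monic /\ irreducible_poly w.
  by move=> /(fintype.subsetP JI) /and3P[wm /irreducibleP wi _].
have := prod_coprime_dvdp (irreducible_seq_coprime k Jirr) (f := f).
rewrite big_map big_enum; apply; apply/allP => _ /mapP[w wJ ->].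
by apply: Jf; rewrite mem_enum in wJ.
Qed.

Lemma coprimep_vprod (J : {set T}) u : (forall w, w \in J -> coprimep u (w : {poly F})) ->
  coprimep u (vprod J).
Proof.
move=> uJ; rewrite /vprod; elim/big_ind: _ => [|v w uv uw|w /uJ //].
  exact: coprimep1.
by rewrite coprimepMr uv uw.
Qed.

Lemma vprod_coprimeX (J : {set T}) : J \subset irrX -> coprimep 'X (vprod J).
Proof.
move=> /fintype.subsetP JI; apply: coprimep_vprod => w /JI /and3P[_ _].
by rewrite irreducible_poly_coprime //; apply: irreducible_polyX.
Qed.

Lemma mem_vprod (J : {set T}) w : J \subset irrX -> irrX w ->
  (w \in J) = ((w : {poly F}) %| vprod J).
Proof.
move=> /fintype.subsetP JI /and3P[wm /irreducibleP wi _]; apply/idP/idP => [wJ|].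
  by rewrite /vprod (bigD1 w) //= dvdp_mulr.
apply: contraLR => wJ; rewrite -irreducible_poly_coprime //.
apply: coprimep_vprod => v vJ; have /and3P[vm /irreducibleP vi _] := JI _ vJ.
apply: coprimep_irreducible => //; apply: contraNneq wJ => /val_inj ->.
by [].
Qed.

Lemma vprod_inj : {in [pred J : {set T} | J \subset irrX] &, injective vprod}.
Proof.
move=> J J' /= JI J'I vJ; apply/setP => w; case: (boolP (irrX w)) => wI.
  by rewrite !mem_vprod // vJ.
by rewrite (contraNF (fintype.subsetP JI w)) ?(contraNF (fintype.subsetP J'I w)).
Qed.

(* The sum of the Moebius function over the squarefree monic polynomials of   *)
(* degree d prime to x.                                                       *)
Definition mobius_sum (R : comNzRingType) d : R :=
  \sum_(J : {set T} | (J \subset irrX) && (pdeg (vprod J) == d)) (-1) ^+ #|J|.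

Lemma card_vprod_deg d :
  (#|[pred J : {set T} | (J \subset irrX) && (pdeg (vprod J) == d)]| <= q ^ d)%N.
Proof.
rewrite -card_npoly.
apply: (@leq_card_in _ _ (fun J => npolyp d (vprod J - 'X^d))).
move=> J J' /andP[JI /eqP Jd] /andP[J'I /eqP J'd].
move=> /(congr1 (fun g : {poly_d F} => g : {poly F})).
have sub_size (K : {set T}) : K \subset irrX -> pdeg (vprod K) = d ->
    (size (vprod K - 'X^d)%R <= d)%N.
  move=> KI Kd; have Km := vprod_monic KI.
  have Ks : size (vprod K) = d.+1.
    by rewrite -Kd /pdeg prednK // size_poly_gt0 monic_neq0.
  apply/leq_sizeP => j; rewrite leq_eqVlt => /orP[/eqP <-|dj].
    move: Km; rewrite monicE lead_coefE Ks => /eqP vd.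
    by rewrite coefB coefXn eqxx vd subrr.
  by rewrite coefB coefXn gtn_eqF // subr0 nth_default // Ks.
rewrite !npolypK ?sub_size // => /addIr; exact: vprod_inj.
Qed.

End SquarefreeProducts.

Section MobiusSums.
Variables (R : fieldType) (F : finFieldType) (N : nat).
Local Notation T := {poly_N.+1 F}.
Local Notation q := #|F|.
Hypothesis q_neq0 : q%:R != 0 :> R.

Lemma size_XnD d (g : {poly_d F}) : size ('X^d + (g : {poly F})) = d.+1.
Proof. by rewrite size_polyDl size_polyXn // ltnS size_npoly. Qed.

Lemma XnD_monic d (g : {poly_d F}) : 'X^d + (g : {poly F}) \is monic.
Proof. by rewrite monicE lead_coefDl ?lead_coefXn // size_polyXn ltnS size_npoly. Qed.

Definition card_multiples d (v : {poly F}) :=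
  #|[pred g : {poly_d F} | (v %| 'X^d + (g : {poly F})) &&
                           ~~ ('X %| 'X^d + (g : {poly F}))]|.

Lemma card_multiples_lt d v : v \is monic -> coprimep 'X v -> (pdeg v < d)%N ->
  (card_multiples d v)%:R = q%:R ^+ (d - pdeg v) * (1 - q%:R^-1) :> R.
Proof.
move=> vm vX vd; have v0 := monic_neq0 vm.
have := @card_avoid_poly F R d (fun=> - 'X^d) [:: 'X] v (- 'X^d) q_neq0 v0.
rewrite /= polyX_eq0 coprimep_sym vX !big_seq1 size_polyX expr1 => <- //; last first.
  by rewrite size_mulX // (pdeg_size vm).
by congr (_%:R); apply: eq_card => g; rewrite !inE opprK addrC andbT.
Qed.

Lemma card_multiples_eq d v : v \is monic -> coprimep 'X v -> pdeg v = d ->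
  card_multiples d v = 1%N.
Proof.
move=> vm vX vd; have v0 := monic_neq0 vm.
have sv : size v = d.+1 by rewrite pdeg_size ?vd.
have := @card_congr_poly F d v (- 'X^d) v0.
rewrite sv subnn expn0 => <- //; apply: eq_card => g.
rewrite !inE opprK addrC; case: (boolP (v %| _)) => //= vg.
have : v %= (g : {poly F}) + 'X^d by rewrite -dvdp_size_eqp // sv addrC size_XnD.
move=> /eqp_dvdr <-; rewrite -irreducible_poly_coprime //.
exact: irreducible_polyX.
Qed.

Lemma card_multiples_gt d v : (d < pdeg v)%N -> card_multiples d v = 0%N.
Proof.
move=> dv; apply: eq_card0 => g; rewrite inE; apply/negP => /andP[vg _].
have := dvdp_leq (monic_neq0 (XnD_monic g)) vg; rewrite size_XnD.
by move: dv; rewrite /pdeg; case: (size v) => //= s; lia.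
Qed.

Lemma sum_mobius_divisors d (g : {poly_d F}) : (0 < d <= N)%N ->
  ~~ ('X %| 'X^d + (g : {poly F})) ->
  \sum_(J : {set T} | (J \subset @irrX F N) && (vprod J %| 'X^d + (g : {poly F})))
    (-1) ^+ #|J| = 0 :> R.
Proof.
move=> /andP[d0 dN] gX; set f := 'X^d + _.
have fm : f \is monic by apply: XnD_monic.
have f0 := monic_neq0 fm; have sf : size f = d.+1 by apply: size_XnD.
pose Q : pred T := fun w => irrX w && ((w : {poly F}) %| f).
have QE (J : {set T}) : (J \subset Q) = (J \subset @irrX F N) && (vprod J %| f).
  apply/fintype.subsetP/andP => [JQ|[JI]].
    have JI : J \subset @irrX F N by apply/fintype.subsetP => w /JQ /andP[].
    split=> //; rewrite -[vprod J]expr1 dvdp_vprodX //; apply/forall_inP => w /JQ.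
    by case/andP.
  rewrite -[vprod J]expr1 dvdp_vprodX // => /forall_inP Jf w wJ.
  by rewrite unfold_in; apply/andP; split; [exact: (fintype.subsetP JI) | exact: Jf].
have [|u [um ui uf]] := @dvdp_monic_irreducible _ f; first by rewrite sf.
have su : (size u <= N.+1)%N by rewrite (leq_trans (dvdp_leq f0 uf)) // sf.
have Qu : Q (npolyp N.+1 u).
  rewrite /Q /irrX npolypK // um (introT (irreducibleP _) ui) uf andbT /=.
  by apply: contra gX => Xu; exact: dvdp_trans Xu uf.
have := @prod_add1_subsets R T Q (fun=> -1).
rewrite (bigD1 (npolyp N.+1 u)) //= subrr mul0r => /esym.
by under eq_bigr do rewrite prodr_const; under eq_bigl do rewrite QE.
Qed.

(* Counts, with sign (-1)^#|J|, the pairs of a set J and a monic multiple of  *)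
(* vprod J of degree d prime to x.                                            *)
Lemma mobius_sum_rec d : (0 < d <= N)%N ->
  mobius_sum F N R d +
  \sum_(e < d) mobius_sum F N R e * (q%:R ^+ (d - e) * (1 - q%:R^-1)) = 0.
Proof.
move=> dN; have : \sum_(g : {poly_d F} | ~~ ('X %| 'X^d + (g : {poly F})))
  \sum_(J : {set T} | (J \subset @irrX F N) && (vprod J %| 'X^d + (g : {poly F})))
    (-1) ^+ #|J| = 0 :> R.
  by apply: big1 => g; apply: sum_mobius_divisors.
rewrite (exchange_big_dep (fun J : {set T} => J \subset @irrX F N)) /=; last first.
  by move=> g J _ /andP[].
under eq_bigr => J JI.
  rewrite sumr_const -mulr_natr.
  rewrite (_ : #|_| = card_multiples d (vprod J)); last first.
    by apply: eq_card => g; rewrite !inE JI andbC.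
  over.
pose c e : R := if (e < d)%N then q%:R ^+ (d - e) * (1 - q%:R^-1) else 1.
rewrite (eq_bigr (fun J : {set T} => \sum_(e < d.+1 | e == pdeg (vprod J) :> nat)
    (-1) ^+ #|J| * c e)); last first.
  move=> J JI; have Jm := vprod_monic JI; have JX := vprod_coprimeX JI.
  rewrite (big_ord1_eq +%R (fun e => (-1) ^+ #|J| * c e)) /c ltnS.
  case: (ltngtP (pdeg (vprod J)) d) => Jd.
  - by rewrite card_multiples_lt.
  - by rewrite card_multiples_gt // mulr0.
  - by rewrite card_multiples_eq.
rewrite (exchange_big_dep predT) //= big_ord_recr /= addrC => e0.
rewrite -[RHS]e0; congr (_ + _).
  rewrite /c ltnn /mobius_sum; apply: eq_big => J; rewrite ?mulr1 //.
  by rewrite [d == _]eq_sym.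
apply: eq_bigr => e _; rewrite /mobius_sum mulr_suml /c ltn_ord.
by apply: eq_bigl => J; rewrite [(_ : nat) == _]eq_sym.
Qed.

Lemma mobius_sum0 : mobius_sum F N R 0 = 1.
Proof.
rewrite /mobius_sum (bigD1 finset.set0) /=; last first.
  apply/andP; split; first by apply/fintype.subsetP => w; rewrite inE.
  by rewrite /vprod big_set0 /pdeg size_poly1.
rewrite cards0 expr0 big1 ?addr0 // => J /andP[/andP[JI /eqP J0] /eqP Jn0].
case: Jn0; apply/setP => w; rewrite [RHS]inE; apply/negbTE/negP => wJ.
have Jm := vprod_monic JI; have := pdeg_size Jm; rewrite J0 => J1.
have wI := fintype.subsetP JI _ wJ; have := wJ; rewrite (mem_vprod JI wI).
case/and3P: wI => _ /irreducibleP[w1 _] _ /(dvdp_leq (monic_neq0 Jm)).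
by rewrite J1 leqNgt w1.
Qed.

Lemma mobius_sumE d : (0 < d <= N)%N -> mobius_sum F N R d = 1 - q%:R.
Proof.
case: d => // d; elim: d => [|d IHd] dN.
  have := mobius_sum_rec dN; rewrite big_ord1 mobius_sum0 mul1r subn0 expr1.
  by move=> /eqP; rewrite addr_eq0 => /eqP ->; field.
have IH := IHd (ltnW dN).
have dN' : (0 < d.+1 <= N)%N by apply: ltnW.
have := mobius_sum_rec dN; rewrite big_ord_recr /=.
have : \sum_(e < d.+1) mobius_sum F N R e * (q%:R ^+ (d.+2 - e) * (1 - q%:R^-1)) =
    - q%:R * mobius_sum F N R d.+1.
  have /eqP := mobius_sum_rec dN'; rewrite addr_eq0 => /eqP ->.
  rewrite mulNr mulrN opprK mulr_sumr; apply: eq_bigr => e _.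
  by rewrite subSn ?(ltnW (ltn_ord e)) // exprS; ring.
move=> ->; rewrite IH subSn // subnn expr1 => /eqP.
by rewrite addr_eq0 => /eqP ->; field.
Qed.

End MobiusSums.

(** * Odd primes *)

Lemma sqirr_density_expand (R : realType) (F : finFieldType) (N : nat) (f : {poly F}) :
  ~~ ('X %| f) ->
  sqirr_density N.+1 R f =
  \sum_(J : {set {poly_N.+1 F}} | (J \subset @irrX F N) && (vprod J ^+ 2 %| f))
     (-1) ^+ #|J| / #|F|%:R ^+ pdeg (vprod J).
Proof.
move=> Xf; rewrite /sqirr_density (prod_add1_subsets (sqirr f)).
apply: eq_big => [J|J JQ].
  apply/fintype.subsetP/andP => [JQ|[JI]].
    have JI : J \subset @irrX F N.
      apply/fintype.subsetP => w /JQ /and3P[wm wi wf]; apply/and3P; split=> //.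
      apply: contra Xf => Xw; apply: dvdp_trans Xw _; apply: dvdp_trans wf.
      by rewrite expr2 dvdp_mulr.
    by split=> //; rewrite dvdp_vprodX //; apply/forall_inP => w /JQ /and3P[].
  rewrite dvdp_vprodX // => /forall_inP Jf w wJ.
  have /and3P[wm wi _] := fintype.subsetP JI _ wJ.
  by rewrite unfold_in; apply/and3P; split=> //; apply: Jf.
rewrite prodrN; congr (_ * _).
rewrite /vprod pdeg_prod => [|w /(fintype.subsetP JQ) /and3P[] //].
by rewrite -prodrXr prodfV.
Qed.

Section OddPrime.
Variables (R : realType) (p : nat) (n : nat).
Hypothesis p_pr : prime p.
Hypothesis n_gt0 : (0 < n)%N.
Local Notation T := {poly_n.+1 'F_p}.
Implicit Types (J : {set T}).

Definition multiple_rows (v : {poly 'F_p}) : nat :=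
  #|[pred a : 'rV['F_p]_n | nonzero_row a && (v %| row_monic a)]|.

Lemma nonzero_row_X (a : 'rV['F_p]_n) : nonzero_row a -> ~~ ('X %| row_monic a).
Proof.
move=> /forallP a0; have := a0 (Ordinal n_gt0); apply: contra => /dvdpP[g gE].
have := coef_row_poly a (Ordinal n_gt0) => /= <-.
have : (row_monic a)`_0 = 0 by rewrite gE coefMX.
by rewrite coefD coefXn ltn_eqF // add0r => ->.
Qed.

Lemma multiple_rows_delta (v : {poly 'F_p}) : v \is monic -> coprimep 'X v ->
  `|(multiple_rows v)%:R / (p.-1)%:R ^+ n - (p%:R ^+ pdeg v)^-1| <= delta R n p (pdeg v).
Proof.
move=> vm vX; set d := pdeg v; have sv : size v = d.+1 by apply: pdeg_size.
pose u : {poly_d.+1 'F_p} := npolyp d.+1 v.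
have uE : u = v :> {poly 'F_p} by rewrite npolypK ?sv.
pose al : {poly_d 'F_p} := npolyp d ((- 'X^n) %% v).
have alE : al = (- 'X^n) %% v :> {poly 'F_p}.
  by rewrite npolypK // -ltnS -sv ltn_modp monic_neq0.
have -> : multiple_rows v = #|A_set n u al|.
  pose rev (a : 'rV['F_p]_n) : 'rV['F_p]_n := \row_i a 0 (rev_ord i).
  have revK : involutive rev.
    by move=> a; apply/rowP => i; rewrite !mxE rev_ordK.
  rewrite -[RHS]sum1_card (reindex rev); last by apply: onW_bij; exists rev.
  rewrite sum1_card; apply: eq_card => a.
  rewrite [RHS](_ : _ = (rev a \in A_set n u al)) // /A_set !inE; congr (_ && _).
    apply/forallP/forallP => H i; first by rewrite mxE.
    by have := H (rev_ord i); rewrite mxE rev_ordK.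
  have -> : \sum_(i < n) rev a 0 i *: 'X^(n - i.+1) = row_poly a.
    rewrite (reindex_inj rev_ord_inj); apply: eq_bigr => i _.
    rewrite mxE rev_ordK; congr (_ *: 'X^_) => /=.
    by have := ltn_ord i; lia.
  rewrite uE alE /row_monic.
  rewrite [in LHS](_ : 'X^n + row_poly a = row_poly a - (- 'X^n) %% v - (- 'X^n) %/ v * v).
    by rewrite dvdp_subl // dvdp_mull.
  by rewrite -addrA -opprD [X in - X]addrC -divp_eq opprK addrC.
rewrite /delta; apply: (bigmax_sup u).
  rewrite uE vm sv eqxx /= -irreducible_poly_coprime //.
  exact: irreducible_polyX.
exact: (bigmax_sup al).
Qed.

Lemma multiple_rows_gt (v : {poly 'F_p}) : (n < pdeg v)%N -> multiple_rows v = 0%N.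
Proof.
move=> nv; apply: eq_card0 => a; rewrite inE; apply/negP => /andP[_ va].
have := dvdp_leq (monic_neq0 (row_monic_monic a)) va; rewrite size_row_monic.
by move: nv; rewrite /pdeg; case: (size v) => //= s; lia.
Qed.

Lemma mobius_partial_sum (D : nat) : (D <= n)%N ->
  \sum_(d < D.+1) mobius_sum 'F_p n R d / p%:R ^+ (3 * d) =
  1 - (1 - (p%:R ^+ (3 * D))^-1) / (p ^ 2 + p + 1)%:R.
Proof.
have p0 : p%:R != 0 :> R by rewrite pnatr_eq0 -lt0n prime_gt0.
have s0 : (p ^ 2 + p + 1)%:R != 0 :> R by rewrite pnatr_eq0 addn1.
have q0 : #|'F_p|%:R != 0 :> R by rewrite card_Fp.
elim: D => [|D IHD] Dn.
  by rewrite big_ord1 mobius_sum0 // muln0 expr0 invr1 subrr mul0r subr0 mulr1.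
rewrite big_ord_recr /= IHD 1?ltnW // mobius_sumE // card_Fp //.
rewrite mulnS exprD; have pD0 : p%:R ^+ (3 * D) != 0 :> R by rewrite expf_neq0.
move: (p%:R ^+ (3 * D)) pD0 s0 => x x0; rewrite !natrD natrX => s0.
by field; rewrite x0 p0 s0.
Qed.

Lemma sum_density_delta :
  `| (\sum_(a : 'rV['F_p]_n | nonzero_row a) sqirr_density n.+1 R (row_monic a))
      / (p.-1)%:R ^+ n
     - \sum_(d < (n %/ 2).+1) mobius_sum 'F_p n R d / p%:R ^+ (3 * d) |
  <= \sum_(d < (n %/ 2).+1) delta R n p (2 * d).
Proof.
have q_card : #|'F_p| = p by rewrite card_Fp.
have p0 : 0 < p%:R :> R by rewrite ltr0n prime_gt0.
pose B J : R := (multiple_rows (vprod J ^+ 2))%:R / (p.-1)%:R ^+ n.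
pose t J : R := (-1) ^+ #|J| / p%:R ^+ pdeg (vprod J).
have pdeg2 J : J \subset @irrX _ n -> pdeg (vprod J ^+ 2) = (2 * pdeg (vprod J))%N.
  by move=> /vprod_monic Jm; rewrite expr2 pdegM // mul2n addnn.
have -> : (\sum_(a : 'rV['F_p]_n | nonzero_row a) sqirr_density n.+1 R (row_monic a))
      / (p.-1)%:R ^+ n = \sum_(J : {set T} | J \subset @irrX _ n) t J * B J.
  under eq_bigr => a a0 do rewrite sqirr_density_expand ?nonzero_row_X //.
  rewrite (exchange_big_dep (fun J : {set T} => J \subset @irrX 'F_p n)) /=; last first.
    by move=> a J _ /andP[].
  rewrite mulr_suml; apply: eq_bigr => J JI.
  rewrite /t /B sumr_const q_card -[(_ / _) *+ _]mulr_natr [RHS]mulrA; congr (_ * _%:R / _).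
  by apply: eq_card => a; rewrite !inE JI.
have -> : \sum_(J : {set T} | J \subset @irrX _ n) t J * B J =
   \sum_(d < (n %/ 2).+1)
     \sum_(J : {set T} | (J \subset @irrX _ n) && (pdeg (vprod J) == d)) t J * B J.
  rewrite (eq_bigr (fun J : {set T} =>
    \sum_(d < (n %/ 2).+1 | d == pdeg (vprod J) :> nat) t J * B J)); last first.
    move=> J JI; rewrite (big_ord1_eq +%R (fun=> t J * B J)) ltnS.
    case: leqP => // Jn; rewrite /B multiple_rows_gt ?mul0r ?mulr0 //.
    by rewrite pdeg2 //; lia.
  rewrite (exchange_big_dep predT) //=; apply: eq_bigr => d _.
  by apply: eq_bigl => J; rewrite [(_ : nat) == _]eq_sym.
rewrite -sumrB; apply: (le_trans (ler_norm_sum _ _ _)); apply: ler_sum => d _.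
rewrite /mobius_sum mulr_suml -sumrB.
apply: (le_trans (ler_norm_sum _ _ _)).
apply: (@le_trans _ _ (\sum_(J : {set T} | (J \subset @irrX 'F_p n) && (pdeg (vprod J) == d))
    (p%:R ^+ d)^-1 * delta R n p (2 * d))).
  apply: ler_sum => J /andP[JI /eqP Jd]; have Jm := vprod_monic JI.
  have -> : t J * B J - (-1) ^+ #|J| / p%:R ^+ (3 * d) =
      (-1) ^+ #|J| * ((p%:R ^+ d)^-1 * (B J - (p%:R ^+ (2 * d))^-1)).
    have -> : (3 * d = d + 2 * d)%N by lia.
    rewrite /t Jd exprD invfM; move: (_ ^+ #|J|) (B J) (_ ^- _) (_ ^- _).
    by clear=> s b x y; ring.
  rewrite normrM normrX normrN1 expr1n mul1r normrM ger0_norm; last first.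
    by rewrite invr_ge0 exprn_ge0 // ltW.
  rewrite ler_wpM2l ?invr_ge0 ?exprn_ge0 ?(ltW p0) //.
  rewrite -Jd -pdeg2 //; apply: multiple_rows_delta; first exact: rpredX.
  by apply: coprimep_expr; apply: vprod_coprimeX.
rewrite sumr_const -[_ *+ #|_|]mulr_natl mulrA; apply: ler_piMl.
  rewrite /delta; elim/big_ind: _ => // [x y x0 y0|u _]; first by rewrite le_max x0.
  by elim/big_ind: _ => // x y x0 y0; rewrite le_max x0.
rewrite ler_pdivrMr ?exprn_gt0 // mul1r -natrX ler_nat.
by have := card_vprod_deg 'F_p n d; rewrite q_card.
Qed.

Lemma mobius_tail :
  `| \sum_(d < (n %/ 2).+1) mobius_sum 'F_p n R d / p%:R ^+ (3 * d)
     - (1 - 1 / (p ^ 2 + p + 1)%:R) | <= 1 / p%:R ^+ n.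
Proof.
have p1 : 1 <= p%:R :> R by rewrite ler1n prime_gt0.
have p0 : 0 < p%:R :> R by rewrite ltr0n prime_gt0.
rewrite mobius_partial_sum; last by rewrite leq_div.
set y := (_ ^+ _)^-1; set s := _%:R.
have -> : 1 - (1 - y) / s - (1 - 1 / s) = s^-1 * y by ring.
rewrite {}/y {}/s ger0_norm; last by rewrite mulr_ge0 // invr_ge0 ?exprn_ge0 // ltW.
rewrite -invfM div1r lef_pV2 ?posrE ?mulr_gt0 ?ltr0n ?addn1 ?(exprn_gt0 _ p0) //.
apply: (@le_trans _ _ (p%:R ^+ (2 + 3 * (n %/ 2)))).
  by rewrite ler_weXn2l //; lia.
rewrite exprD ler_wpM2r ?exprn_ge0 ?(ltW p0) // -natrX ler_nat.
by rewrite leqW // leq_addr.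
Qed.

End OddPrime.

(** * The prime two *)

Lemma dvdn_ord2 (d j : nat) : odd d -> (ord2 d %| j)%N = (d %| 2 ^ j - 1)%N.
Proof.
move=> d_odd; rewrite /ord2; have [d1|d_neq1] := eqVneq d 1%N.
  subst d; rewrite /insubd insubN ?order1 ?dvd1n //.
have d_gt1 : (1 < d)%N by case: d d_odd d_neq1 => [|[]].
have two_unit : (2%:R : 'Z_d) \is a GRing.unit.
  by rewrite unitZpE // coprime_sym coprime2n.
rewrite order_dvdn -val_eqE /= FinRing.val_unitX val_insubd two_unit.
rewrite -natrX -val_eqE /= val_Zp_nat //.
by rewrite Zp_cast // eqn_mod_dvd // expn_gt0.
Qed.

Lemma ord2_gt0 (d : nat) : (0 < ord2 d)%N.
Proof. exact: order_gt0. Qed.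

Section PolyOrder.
Variable F : fieldType.
Implicit Types w : {poly F}.

Lemma dvdp_XnsubM a b : ('X^a - 1 : {poly F}) %| 'X^(a * b) - 1.
Proof. by rewrite exprM [X in _ %| X]subrX1 dvdp_mulr. Qed.

(* The order of X modulo w, provided it is at most t. *)
Definition xorder t w : nat := (find (fun d => (w %| 'X^(d.+1) - 1)%R) (iota 0 t)).+1.

Lemma xorder_dvdp t w b : (0 < t)%N -> w %| 'X^t - 1 -> coprimep w 'X ->
  (w %| 'X^b - 1) = (xorder t w %| b)%N.
Proof.
move=> t0 wt wX; set e := xorder t w.
have has_t : has (fun d => w %| 'X^(d.+1) - 1) (iota 0 t).
  by apply/hasP; exists t.-1; rewrite ?prednK // mem_iota add0n prednK ?leqnn.
have we : w %| 'X^e - 1.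
  have := nth_find 0%N has_t; rewrite nth_iota ?add0n //.
  by move: has_t; rewrite has_find size_iota.
have min r : (0 < r < e)%N -> ~~ (w %| 'X^r - 1).
  case: r => // r; rewrite /= /e /xorder ltnS => re.
  have := before_find 0%N re; rewrite nth_iota ?add0n; first by move=> ->.
  by apply: leq_trans re _; rewrite -[X in (_ <= X)%N](size_iota 0 t) find_size.
apply/idP/dvdnP => [wb|[k ->]]; last first.
  by rewrite mulnC; apply: dvdp_trans we (dvdp_XnsubM _ _).
exists (b %/ e)%N; rewrite {1}(divn_eq b e).
suff -> : (b %% e = 0)%N by rewrite addn0.
have re : (b %% e < e)%N by rewrite ltn_pmod.
apply/eqP; rewrite eqn0Ngt; apply/negP => r0.
have := min (b %% e)%N; rewrite r0 re => /(_ isT) /negP; apply.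
have : w %| 'X^(b %% e) * ('X^(b %/ e * e) - 1).
  by rewrite dvdp_mull // mulnC; apply: dvdp_trans we (dvdp_XnsubM _ _).
have -> : 'X^(b %% e) * ('X^(b %/ e * e) - 1) = ('X^b - 1) - ('X^(b %% e) - 1) :> {poly F}.
  by rewrite mulrBr mulr1 -exprD addnC -divn_eq; ring.
by rewrite dvdp_subr.
Qed.

End PolyOrder.

Lemma F2_frob (c : 'F_2) : c ^+ 2 = c.
Proof. by have := expf_card c; rewrite card_Fp. Qed.

(* In F_2[x]/(w), the iterate x |-> x^(2^o) of Frobenius is the identity as    *)
(* soon as it fixes the class of x.                                           *)
Lemma pdeg_xorder (w : {poly 'F_2}) t : w \is monic -> irreducible_poly w ->
  odd t -> w %| 'X^t - 1 -> (size w).-1 = ord2 (xorder t w).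
Proof.
move=> wm wi t_odd wt; have t0 : (0 < t)%N by case: t t_odd {wt}.
have wX : coprimep w 'X.
  apply/Bezout_eq1_coprimepP; have [g gE] := dvdpP _ _ wt.
  exists (- g, 'X^(t.-1)) => /=; rewrite mulNr -gE -exprSr prednK //.
  by rewrite opprB subrK.
have e_dvd b := xorder_dvdp b t0 wt wX; set e := xorder t w in e_dvd *.
have e_odd : odd e.
  have : (e %| t)%N by rewrite -e_dvd.
  by move=> /dvdnP[k tE]; move: t_odd; rewrite tE oddM => /andP[].
have wmi : monic_irreducible_poly w by split.
pose K := {poly %/ w with wmi}.
have K_card : #|{: K}| = (2 ^ (size w).-1)%N by rewrite card_qfpoly card_Fp.
pose x : K := in_qpoly w 'X.
have in0 (g : {poly 'F_2}) : (in_qpoly w g == 0 :> K) = (w %| g).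
  rewrite dvdpE; apply/eqP/eqP => [/(congr1 (@polyn _ _))|wg].
    by rewrite /= mk_monicE.
  by apply: val_inj; rewrite /= mk_monicE.
have m_gt0 : (0 < (size w).-1)%N by case: wi; case: (size w) => [|[]].
have x0 : (x == 0) = false.
  rewrite in0; apply/negP => wX'; have := coprimep_dvdl wX' wX.
  by rewrite coprimepp; case: wi => + _; case: eqP => // ->.
have fixXE o : (0 < o)%N -> (x ^+ (2 ^ o) == x) = (ord2 e %| o)%N.
  move=> o0; rewrite dvdn_ord2 // -e_dvd -in0 -subr_eq0.
  have -> : x ^+ (2 ^ o) - x = in_qpoly w (('X^(2 ^ o - 1) - 1) * 'X) :> K.
    rewrite mulrBl mul1r -exprSr subn1 prednK ?expn_gt0 //.
    by rewrite rmorphB rmorphXn.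
  by rewrite rmorphM mulf_eq0 -/x x0 orbF.
apply/eqP; rewrite eqn_leq; apply/andP; split; last first.
  by apply: dvdn_leq => //; rewrite -fixXE // -K_card expf_card.
set o := ord2 e; have o0 : (0 < o)%N := ord2_gt0 e.
have xo : x ^+ (2 ^ o) = x by apply/eqP; rewrite fixXE.
have pcharK : 2 \in [pchar K].
  by have : 2 \in [pchar {poly %/ w}] by rewrite pchar_qpoly pchar_Fp.
have pnatK : [pchar K].-nat (2 ^ o)%N by rewrite pnatX pnatE // pcharK.
have fixK (a : K) : a ^+ (2 ^ o) = a.
  have -> : a = in_qpoly w (a : {poly 'F_2}) :> K.
    by apply: val_inj; rewrite [RHS]in_qpoly_small // size_mk_monic.
  elim/poly_ind: (a : {poly 'F_2}) => [|g c IHg].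
    by rewrite in_qpoly0 expr0n expn_eq0.
  rewrite rmorphD rmorphM /= -/x exprDn_pchar //.
  rewrite exprMn IHg xo; congr (_ + _); rewrite -rmorphXn -polyC_exp.
  congr (in_qpoly w _%:P); elim: (o) => [|j IHj]; first by rewrite expr1.
  by rewrite expnSr exprM IHj F2_frob.
have : (#|{: K}| <= 2 ^ o)%N.
  have := @max_poly_roots K ('X^(2 ^ o) - 'X) (enum K).
  rewrite -cardE size_polyDl ?size_polyN ?size_polyX ?size_polyXn ?ltnS; last first.
    by rewrite -[X in (X < _)%N](expn0 2) ltn_exp2l.
  apply; last exact: enum_uniq.
    rewrite -size_poly_gt0 size_polyDl ?size_polyN ?size_polyX ?size_polyXn //.
    by rewrite ltnS -[X in (X < _)%N](expn0 2) ltn_exp2l.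
  by apply/allP => b _; rewrite rootE !hornerE fixK subrr.
by rewrite K_card leq_exp2l.
Qed.

Section FactorsXn1.
Variable N : nat.
Local Notation T := {poly_N.+1 'F_2}.

Definition fac_Xn1 d : pred T := fun w =>
  [&& (w : {poly 'F_2}) \is monic, irreducibleb w & (w : {poly 'F_2}) %| 'X^d - 1].

Lemma fac_Xn1P d (w : T) : fac_Xn1 d w ->
  (w : {poly 'F_2}) \is monic /\ irreducible_poly w.
Proof. by case/and3P=> wm /irreducibleP. Qed.

Lemma Xn1_squarefree d (u : {poly 'F_2}) : odd d ->
  u ^+ 2 %| 'X^d - 1 -> (size u <= 1)%N.
Proof.
move=> d_odd ud; have d0 : d%:R != 0 :> 'F_2.
  by rewrite -val_eqE /= val_Fp_nat // modn2 d_odd.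
have /separable_polyP[+ _] := separable_Xn_sub_1 d0.
by move=> /(_ u u); rewrite -expr2 => /(_ ud); rewrite coprimepp => /eqP ->.
Qed.

Lemma monic_Xn1 d : (0 < d)%N -> 'X^d - 1 \is @monic 'F_2.
Proof. by case: d => // d _; apply: monicXnsubC. Qed.

Lemma sum_pdeg_fac d : odd d -> (d <= N)%N ->
  (\sum_(w : T | fac_Xn1 d w) pdeg w = d)%N.
Proof.
move=> d_odd dN; have d0 : (0 < d)%N by case: d d_odd {dN}.
have fm := monic_Xn1 d0; set f := 'X^d - 1 in fm *.
have sf : size f = d.+1 by apply: size_XnsubC.
rewrite -pdeg_prod => [|w /fac_Xn1P[] //]; set P := \prod_(w | _) _.
have Pm : P \is monic by apply: monic_prod => w /fac_Xn1P[].
have /dvdpP[h fE] : P %| f.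
  have := prod_coprime_dvdp (irreducible_seq_coprime 1 (@fac_Xn1P d)) (f := f).
  rewrite big_map big_enum; apply; apply/allP => _ /mapP[w + ->].
  by rewrite mem_enum => /and3P[].
have h0 : h != 0.
  by apply: contraTneq (monic_neq0 fm) => h0; rewrite fE h0 mul0r eqxx.
have [h1|h1] := ltnP 1 (size h); last first.
  have sh : size h = 1%N by apply/eqP; rewrite eqn_leq h1 size_poly_gt0.
  by move: sf; rewrite fE size_mul ?(monic_neq0 Pm) // sh (pdeg_size Pm) => -[].
have [u [um ui uh]] := dvdp_monic_irreducible h1.
have uf : u %| f by rewrite fE dvdp_mulr.
have su : (size u <= N.+1)%N.
  by rewrite (leq_trans (dvdp_leq (monic_neq0 fm) uf)) // sf.
have uP : u %| P.
  rewrite /P (bigD1 (npolyp N.+1 u)) /=; first by rewrite npolypK // dvdp_mulr.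
  by rewrite /fac_Xn1 npolypK // um uf (introT (irreducibleP _) ui).
have := Xn1_squarefree d_odd (u := u); rewrite -/f fE expr2 dvdp_mul // => /(_ isT).
by case: ui; case: (size u) => [|[]].
Qed.

Variable t : nat.
Hypotheses (t_odd : odd t) (tN : (t <= N)%N).

Let t0 : (0 < t)%N. Proof. by case: t t_odd. Qed.

Lemma odd_dvdn d : (d %| t)%N -> odd d.
Proof. by move=> /dvdnP[k tE]; move: t_odd; rewrite tE oddM => /andP[]. Qed.

Lemma fac_coprimeX w : fac_Xn1 t w -> coprimep w 'X.
Proof.
case/and3P=> wm /irreducibleP wi wt; rewrite irreducible_poly_coprime //.
apply/negP => wX; have : w %| (1 : {poly 'F_2}).
  have -> : 1 = 'X^t - ('X^t - 1) :> {poly 'F_2} by rewrite opprB addrC subrK.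
  by rewrite dvdp_sub // -(prednK t0) exprS dvdp_mulr.
by rewrite dvdp1; case: wi => + _; case: eqP => // ->.
Qed.

Lemma fac_Xn1_dvd d (w : T) : (d %| t)%N ->
  fac_Xn1 d w = fac_Xn1 t w && (xorder t w %| d)%N.
Proof.
move=> dt; apply/idP/andP => [wd|[wt wd]].
  have wt : fac_Xn1 t w.
    case/and3P: wd => wm wi wd; apply/and3P; split=> //.
    by move: dt => /dvdnP[k ->]; rewrite mulnC; apply: dvdp_trans wd (dvdp_XnsubM _ _ _).
  split=> //; case/and3P: (wt) => _ _ wt'.
  by rewrite -xorder_dvdp ?fac_coprimeX //; case/and3P: wd.
case/and3P: (wt) => wm wi wt'; apply/and3P; split=> //.
by rewrite (xorder_dvdp _ t0 wt') ?fac_coprimeX.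
Qed.

Lemma xorder_le (w : T) : fac_Xn1 t w -> (xorder t w %| t)%N.
Proof.
by move=> wt; have := fac_Xn1_dvd w (dvdnn t); rewrite wt => /esym.
Qed.

Definition num_order c := #|[pred w : T | fac_Xn1 t w && (xorder t w == c)]|.

Lemma num_order_totient d : (d %| t)%N -> (num_order d * ord2 d = totient d)%N.
Proof.
elim/ltn_ind: d => d IHd dt; have d_odd := odd_dvdn dt.
have dN : (d <= N)%N by rewrite (leq_trans _ tN) // dvdn_leq.
have : (\sum_(c < d.+1 | c %| d) num_order c * ord2 c =
          \sum_(c < d.+1 | c %| d) totient c)%N.
  rewrite sum_totient_dvd -[RHS](sum_pdeg_fac d_odd dN).
  rewrite (eq_bigl _ _ (fun w => fac_Xn1_dvd w dt)).
  rewrite [RHS](eq_bigr (fun w : T =>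
    (\sum_(c < d.+1 | c == xorder t w :> nat) ord2 c)%N)); last first.
    move=> w /andP[wt wd]; rewrite (big_ord1_eq addn ord2) ltnS.
    have d0 : (0 < d)%N by case: d d_odd {IHd dt dN wd}.
    rewrite (dvdn_leq d0 wd); have [wm wi] := fac_Xn1P wt.
    have /and3P[_ _ wt'] := wt.
    by rewrite /pdeg (pdeg_xorder wm wi t_odd wt').
  rewrite (exchange_big_dep (fun c : 'I_d.+1 => (c %| d)%N)) /=; last first.
    by move=> w c /andP[_ wd] /eqP ->.
  apply: eq_bigr => c cd; rewrite sum_nat_const; congr (_ * _)%N.
  apply: eq_card => w; rewrite !inE [RHS]unfold_in /=.
  by rewrite [(c : nat) == _]eq_sym; case: eqP => [->|_]; rewrite ?cd ?andbT ?andbF.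
rewrite big_mkcond [RHS]big_mkcond !big_ord_recr /= dvdnn.
rewrite (eq_bigr (fun c : 'I_d => if (c %| d)%N then totient c else 0%N)).
  by move/addnI.
move=> c _; case: ifP => // cd; apply: IHd => //.
by apply: dvdn_trans cd dt.
Qed.

Lemma prod_fac_Xn1 (R : realType) :
  \prod_(w : T | fac_Xn1 t w) (1 - (2%:R ^+ (size w).-1)^-1) = p_of R t.
Proof.
rewrite (eq_bigr (fun w : T => \prod_(c < t.+1 | c == xorder t w :> nat)
  (1 - 2%:R ^- ord2 c))); last first.
  move=> w wt; rewrite (big_ord1_eq *%R (fun c => 1 - 2%:R ^- ord2 c)).
  rewrite ltnS dvdn_leq ?xorder_le //; have [wm wi] := fac_Xn1P wt.
  by have /and3P[_ _ wt'] := wt; rewrite (pdeg_xorder wm wi t_odd wt').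
rewrite (exchange_big_dep (fun c : 'I_t.+1 => (c %| t)%N)) /=; last first.
  by move=> w c /xorder_le wd /eqP ->.
rewrite /p_of (perm_big [seq c <- iota 0 t.+1 | (c %| t)%N]); last first.
  apply: uniq_perm; rewrite ?divisors_uniq ?filter_uniq ?iota_uniq // => c.
  rewrite mem_filter -dvdn_divisors // mem_iota add0n ltnS.
  by case: (boolP (c %| t)%N) => //= ct; rewrite (dvdn_leq t0 ct).
rewrite big_filter -[iota 0 t.+1]/(index_iota 0 t.+1) big_mkord.
apply: eq_bigr => c ct; rewrite prodr_const; congr (_ ^+ _).
rewrite -(num_order_totient ct) mulnK ?ord2_gt0 //.
apply: eq_card => w; rewrite !inE [LHS]unfold_in /=.
by rewrite [(c : nat) == _]eq_sym.
Qed.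

End FactorsXn1.

Section PrimeTwo.
Variables (R : realType) (n k t : nat).
Hypotheses (n_gt0 : (0 < n)%N) (nE : n.+1 = (2 ^ k * t)%N) (t_odd : odd t).
Implicit Types w : {poly 'F_2}.

Let f : {poly 'F_2} := row_monic (const_mx 1 : 'rV['F_2]_n).
Let g : {poly 'F_2} := 'X^t - 1.

Lemma Frobenius_Xn1 : 'X^(2 ^ k * t) - 1 = g ^+ (2 ^ k).
Proof.
have pnat2 : [pchar {poly 'F_2}].-nat (2 ^ k)%N.
  by rewrite pnatX pnatE // pchar_poly pchar_Fp.
by rewrite /g exprDn_pchar // exprNn_pchar // expr1n mulnC exprM.
Qed.

Lemma row_monic1_mul : f * ('X - 1) = g ^+ (2 ^ k).
Proof.
rewrite -Frobenius_Xn1 -nE subrX1 big_ord_recr /= mulrC addrC; congr (_ * (_ + _)).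
by apply: eq_bigr => i _; rewrite mxE scale1r.
Qed.

Lemma dvdp_exp_irreducible w (h : {poly 'F_2}) m : irreducible_poly w ->
  w %| h ^+ m -> w %| h.
Proof.
move=> wi; elim: m => [|m IHm].
  by rewrite dvdp1; case: wi => + _; case: eqP => // ->.
by rewrite exprS irreducible_dvdp_mul // => /orP[//|/IHm].
Qed.

Lemma sqr_dvdp_row_monic1 w : (0 < k)%N -> w \is monic -> irreducible_poly w ->
  w != 'X - 1 -> (w ^+ 2 %| f) = (w %| g).
Proof.
move=> k0 wm wi wc.
have wc' : coprimep (w ^+ 2) ('X - 1).
  apply/coprimep_expl/coprimep_irreducible => //; first exact: monicXsubC.
  exact: irredp_XsubC.
rewrite -(Gauss_dvdpl _ wc') row_monic1_mul; apply/idP/idP => [wg|wg].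
  apply: (dvdp_exp_irreducible wi (m := (2 ^ k)%N)); apply: dvdp_trans wg.
  by rewrite expr2 dvdp_mulr.
apply: dvdp_trans (dvdp_exp2r 2 wg) _; rewrite dvdp_exp2l //.
by rewrite -[X in (X <= _)%N](expn1 2) leq_exp2l.
Qed.

Lemma sqr_X1_dvdp_row_monic1 : ('X - 1) ^+ 2 %| f = (1 < k)%N.
Proof.
have c0 : 'X - 1 != 0 :> {poly 'F_2} by rewrite monic_neq0 // monicXsubC.
have c_irr : irreducible_poly ('X - 1 : {poly 'F_2}) by apply: irredp_XsubC.
have cg : 'X - 1 %| g.
  by rewrite /g -(mul1n t) (dvdp_trans _ (dvdp_XnsubM _ 1 t)) ?expr1.
rewrite -(dvdp_mul2r _ _ c0) row_monic1_mul -exprSr.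
apply/idP/idP => [|k1]; last first.
  apply: dvdp_trans (dvdp_exp2r 3 cg) _; rewrite dvdp_exp2l //.
  by rewrite (@leq_trans (2 ^ 2)) // leq_exp2l.
apply: contraLR; rewrite -leqNgt => k1.
have /dvdpP[h gE] := cg; have hc : ~~ ('X - 1 %| h).
  apply/negP => ch; have := Xn1_squarefree (u := 'X - 1) t_odd.
  rewrite -/g gE expr2 dvdp_mul // => /(_ isT).
  by rewrite size_XsubC.
have : ('X - 1) ^+ (2 ^ k) != 0 :> {poly 'F_2} by rewrite expf_neq0.
move=> ck0; apply: contra hc => cgk.
apply: (dvdp_exp_irreducible c_irr (m := (2 ^ k)%N)).
rewrite -(dvdp_mul2r _ _ ck0) -exprMn -gE -exprS; apply: dvdp_trans cgk.
by rewrite dvdp_exp2l // ltnS -[X in (_ <= X)%N](expn1 2) leq_exp2l.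
Qed.

Lemma sqirr_density_row1 : sqirr_density n.+1 R f =
  if k == 0%N then 1 else if k == 1%N then 2 * p_of R t else p_of R t.
Proof.
have F2_card : #|'F_2| = 2 by rewrite card_Fp.
have [k0|k0] := posnP k.
  rewrite /sqirr_density big_pred0 // => w; apply/negP.
  case/and3P => wm /irreducibleP wi wf.
  have := Xn1_squarefree (u := w) t_odd; rewrite -/g -[g]expr1.
  have := row_monic1_mul; rewrite k0 => <-; rewrite dvdp_mulr // => /(_ isT).
  by case: wi; case: (size w) => [|[]].
have tn : (t <= n)%N.
  by rewrite -ltnS nE ltn_Pmull ?odd_gt0 // -{1}(expn0 2) ltn_exp2l.
rewrite -(prod_fac_Xn1 t_odd tn R) /sqirr_density F2_card.
pose c : {poly_n.+1 'F_2} := npolyp n.+1 ('X - 1).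
have cE : c = 'X - 1 :> {poly 'F_2} by rewrite npolypK // size_XsubC.
have c_irr : irreducible_poly ('X - 1 : {poly 'F_2}) by apply: irredp_XsubC.
have fac_c : fac_Xn1 t c.
  rewrite /fac_Xn1 cE monicXsubC (introT (irreducibleP _) c_irr) /=.
  by rewrite -{1}(expr1 'X) -(mul1n t) dvdp_XnsubM.
have sqirrE (w : {poly_n.+1 'F_2}) : sqirr f w = fac_Xn1 t w && ((w != c) || (1 < k)%N).
  have [->|wc] := eqVneq w c.
    rewrite fac_c /sqirr cE sqr_X1_dvdp_row_monic1 monicXsubC.
    by rewrite (introT (irreducibleP _) c_irr).
  rewrite andbT; apply/and3P/and3P => [[wm wi wf]|[wm wi wg]]; split=> //.
    by rewrite -sqr_dvdp_row_monic1 //; [exact/irreducibleP | rewrite -cE (inj_eq val_inj)].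
  by rewrite sqr_dvdp_row_monic1 //; [exact/irreducibleP | rewrite -cE (inj_eq val_inj)].
rewrite (eq_bigl _ _ sqirrE).
have [k1|k1] := eqVneq k 1%N; last first.
  apply: eq_bigl => w; have -> : (1 < k)%N by rewrite ltn_neqAle eq_sym k1.
  by rewrite orbT andbT.
rewrite [in RHS](bigD1 c) //= cE size_XsubC expr1 mulrA.
have -> : 2 * (1 - 2^-1) = 1 :> R by lra.
by rewrite mul1r; apply: eq_bigl => w; rewrite k1 orbF.
Qed.

End PrimeTwo.

Lemma Pmax_two (R : realType) (n k t : nat) (p_pr : prime 2)
    (mu : probability (padic_space p_pr n) R) :
  (0 < n)%N -> is_haar mu -> n.+1 = (2 ^ k * t)%N -> odd t ->
  Pmax mu = if k == 0%N then 1 else if k == 1%N then 2 * p_of R t else p_of R t.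
Proof.
move=> n0 mu_haar nE t_odd; rewrite PmaxE // expr1n divr1.
rewrite (big_pred1 (const_mx 1)); first exact: sqirr_density_row1.
move=> a; apply/forallP/eqP => [a0|-> i]; last by rewrite mxE oner_neq0.
apply/rowP => i; rewrite mxE; have := a0 i.
by case: (a 0 i) => -[|[|m]] im // _; apply: val_inj.
Qed.

Theorem theorem3p2 (R : realType) :
  (forall (n : nat) (p_pr : prime 2) (mu : probability (padic_space p_pr n) R),
     (2 <= n)%N -> is_haar mu ->
     let t := (n.+1`_2^')%N in
     [/\ odd n.+1 -> Pmax mu = 1,
         (n.+1 = 2 %[mod 4])%N -> Pmax mu = 2 * p_of R t
       & (n.+1 = 0 %[mod 4])%N -> Pmax mu = p_of R t]) /\
  (exists C : R,
     forall (p n : nat) (p_pr : prime p)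
       (mu : probability (padic_space p_pr n) R),
     odd p -> (2 <= n)%N -> is_haar mu ->
     `|Pmax mu - (1 - 1 / (p ^ 2 + p + 1)%:R)|
       <= C * (\sum_(0 <= d < (n %/ 2).+1) delta R n p (2 * d)
               + 1 / p%:R ^+ n)).
Proof.
split=> [n p_pr mu n2 mu_haar t|].
  pose k := logn 2 n.+1.
  have nE : n.+1 = (2 ^ k * t)%N by rewrite /t -p_part partnC.
  have t_odd : odd t.
    have : (2^'.-nat t)%N by apply: part_pnat.
    by rewrite p'natE // dvdn2 negbK.
  rewrite (Pmax_two (ltnW n2) mu_haar nE t_odd).
  have [s sE] : exists s, t = (s * 2).+1.
    by exists t./2; rewrite muln2 -[LHS]odd_double_half t_odd.
  clearbody k t; rewrite nE; case: k {nE} => [|[|k]].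
  - by rewrite expn0 mul1n; split=> // t4; exfalso; lia.
  - by rewrite expn1; split=> // t4; exfalso; lia.
  - by rewrite !expnS -!mulnA; split=> // t4; exfalso; lia.
exists 1 => p n p_pr mu p_odd n2 mu_haar; have n_gt0 := ltnW n2.
rewrite PmaxE // big_mkord [leRHS]mul1r.
apply: le_trans (lerD (sum_density_delta R p_pr n_gt0) (mobius_tail R p_pr n_gt0)).
by apply: le_trans (ler_normD _ _); rewrite addrA subrK.
Qed.
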